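(* Let $(N,J,\nabla,\xi)$ be a conical special complex manifold which is the total space of a (holomorphic) principal $\mathbb C^*$-bundle $p_N:N\to\bar N$, the base of which is a projective special complex manifold $\bar N$ with $\dim_{\mathbb R}\bar N=2n\ge4$. Then the c-projective Weyl curvature of the canonically induced c-projective structure $\mathcal P_{\bar\nabla'}$ on $\bar N$ is $$W^{c,\mathcal P_{\bar\nabla'}}=-\frac14[\bar B,\bar B]-\frac1{4(n+1)}\bar{\mathcal B}_{\bar J}\otimes\bar J+\frac1{8(n+1)}\bar{\mathcal B}\wedge\mathrm{Id}-\frac1{8(n+1)}\bar{\mathcal B}_{\bar J}\wedge\bar J.$$ In particular, $W^{c,\mathcal P_{\bar\nabla'}}_{\bar J(\cdot),\bar J(\cdot)}=W^{c,\mathcal P_{\bar\nabla'}}$, that is, $W^{c,\mathcal P_{\bar\nabla'}}$ is of type $(1,1)$ as an $\mathrm{End}(T\bar N)$-valued two-form.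
   Context: A special complex manifold $(N,J,\nabla)$ is a complex manifold $(N,J)$ with a torsion-free flat connection $\nabla$ such that $\nabla J$ is symmetric, i.e. $(\nabla_XJ)Y=(\nabla_YJ)X$. A conical special complex manifold $(N,J,\nabla,\xi)$ is a special complex manifold with a vector field $\xi$ such that $\nabla\xi=\mathrm{id}$ and $L_\xi J=0$. Put $A=\nabla J$ and $\nabla'=\nabla-\tfrac12JA$, a torsion-free connection with $\nabla'J=0$. Projective special complex manifold: the quotient $\bar N=N/\langle\xi,J\xi\rangle$ with induced complex structure $\bar J$, when $p_N:N\to\bar N$ is a principal $\mathbb C^*$-bundle with principal action generated by $\xi-\sqrt{-1}J\xi$ (so $\xi,J\xi$ are the fundamental vector fields of $1,\sqrt{-1}\in\mathrm{Lie}\,\mathbb C^*=\mathbb C$). c-projective structures: torsion-free complex connections $\nabla^1,\nabla^2$ on a complex manifold are c-projectively related if $\nabla^1_XY=\nabla^2_XY+\theta(X)Y+\theta(Y)X-\theta(JX)JY-\theta(JY)JX$ for some one-form $\theta$; classes are c-projective structures. The canonical structure $\mathcal P_{\bar\nabla'}$ on $\bar N$ is the class of $\bar\nabla'^{\eta}_XY=p_{N*}(\nabla'_{\tilde X}\tilde Y)$, where $\eta$ is any principal connection on $p_N$ of type $(1,0)$ (i.e. with $J$-invariant kernel) and $\tilde X$ denotes the $\eta$-horizontal lift; the class is independent of $\eta$. Tensors $\bar B,\bar{\mathcal B}$: in a local trivialization $p_N^{-1}(\bar U)\cong\bar U\times\mathbb C^*$ with polar coordinates $(r,\theta)$ such that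 $\xi=r\partial_r$, $J\xi=\partial_\theta$, put $B=e^{2\theta J}A=(\cos2\theta\,\mathrm{id}+\sin2\theta\,J)A$. $B$ is horizontal ($B_\xi=B_{J\xi}=0$) and $\mathbb C^*$-invariant, so it induces a locally defined symmetric $(1,2)$-tensor $\bar B$ on $\bar U\subset\bar N$. The tensor $(X,Y)\mapsto\bar B_X\circ\bar B_Y$ is globally defined on $\bar N$; write $[\bar B,\bar B]_{X,Y}=[\bar B_X,\bar B_Y]$ and $\bar{\mathcal B}(X,Y)=\mathrm{Tr}\,\bar B_X\bar B_Y$. Notation: for a $(0,2)$-tensor $k$, $k_{\bar J}(X,Y)=k(X,\bar JY)$; $k^s,k^a$ are its symmetrization and anti-symmetrization, $k^{s}(X,Y)=\tfrac12(k(X,Y)+k(Y,X))$, $k^{a}(X,Y)=\tfrac12(k(X,Y)-k(Y,X))$; for a $(1,1)$-tensor $K$, $(k\wedge K)_{X,Y}Z=k(X,Z)KY-k(Y,Z)KX$. c-projective Weyl curvature: for a torsion-free complex connection $D$ on a complex manifold $(\bar N,\bar J)$ of real dimension $2m\ge4$, with $Ric^D(Y,Z)=\mathrm{Tr}(X\mapsto R^D_{X,Y}Z)$, the Rho tensor is $$P^D(X,Y)=\frac1{m+1}\Big(Ric^D(X,Y)+\frac1{m-1}\big((Ric^D)^s(X,Y)-(Ric^D)^s(\bar JX,\bar JY)\big)\Big),$$ and the c-projective Weyl curvature of the class $[D]$ is $$W^{c,[D]}=R^D+(P^D)^a\otimes\mathrm{Id}-(P^D_{\bar J})^a\otimes\bar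 J+\tfrac12P^D\wedge\mathrm{Id}-\tfrac12P^D_{\bar J}\wedge\bar J.$$ *)

(* Defs.v *)
From HB Require Import structures.
From mathcomp Require Import all_boot all_order all_algebra.
From mathcomp Require Import all_classical all_reals all_analysis.

Set Implicit Arguments.
Unset Strict Implicit.
Unset Printing Implicit Defensive.
Import Order.TTheory GRing.Theory Num.Theory.
Import numFieldNormedType.Exports.
Local Open Scope classical_set_scope.
Local Open Scope ring_scope.

Fixpoint Ck_on (R : realType) (E F : normedModType R) (k : nat)
    (U : set E) (f : E -> F) : Prop :=
  match k with
  | 0%N => forall x, U x -> {for x, continuous f}
  | k'.+1 => (forall x, U x -> differentiable f x) /\
             (forall v, Ck_on k' U (fun x => 'D_v f x))
  end.

(* Used for open [U] only. *)
Definition smooth_on (R : realType) (E F : normedModType R)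
    (U : set E) (f : E -> F) : Prop := forall k, Ck_on k U f.

Definition smooth_near (R : realType) (E F : normedModType R)
    (x : E) (f : E -> F) : Prop :=
  exists U : set E, [/\ open U, U x & smooth_on U f].

(* A real normed space with a complex structure, the multiplication by i. *)
Record cmodel (R : realType) := CModel {
  cE : normedModType R;
  cJ : cE -> cE
}.
Arguments cJ {R c} _.

(* C^n as R^n + i R^n. *)
Definition Cn (R : realType) (n : nat) : cmodel R :=
  @CModel R 'rV[R]_(n + n) (fun v => row_mx (- rsubmx v) (lsubmx v)).

Definition C1 (R : realType) : cmodel R :=
  @CModel R (R^o * R^o)%type (fun c => (- c.2, c.1)).

Definition cprod (R : realType) (E F : cmodel R) : cmodel R :=
  @CModel R (cE E * cE F)%type (fun v => (cJ v.1, cJ v.2)).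

Definition cone (R : realType) : cE (C1 R) := (1, 0).
Definition cimag (R : realType) : cE (C1 R) := (0, 1).
Definition cmul (R : realType) (a b : cE (C1 R)) : cE (C1 R) :=
  (a.1 * b.1 - a.2 * b.2, a.1 * b.2 + a.2 * b.1).

(* An atlas indexed by the points of the space: [chart x], with inverse
   [chart_inv x], is a chart on the neighbourhood [chart_dom x] of [x].
   The tangent space at [x] is identified with the model space [E] by means of
   this preferred chart. As charts are holomorphic, the complex structure of
   the manifold then is [cJ] on each tangent space. *)
Record charted (R : realType) (E : cmodel R) := Charted {
  pt :> topologicalType;
  chart : pt -> pt -> cE E;
  chart_inv : pt -> cE E -> pt;
  chart_dom : pt -> set pt
}.
Arguments chart {R E c} _ _.
Arguments chart_inv {R E c} _ _.
Arguments chart_dom {R E c} _ _.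

Record is_complex_manifold (R : realType) (E : cmodel R) (M : charted E) :
    Prop := IsComplexManifold {
  mfd_hausdorff : hausdorff_space M;
  mfd_second_countable : @second_countable M;
  mfd_dom_open : forall x : M, open (chart_dom x);
  mfd_dom_self : forall x : M, chart_dom x x;
  mfd_img_open : forall x : M, open (chart x @` chart_dom x);
  mfd_chartK : forall x y : M, chart_dom x y -> chart_inv x (chart x y) = y;
  mfd_chart_cont : forall x y : M, chart_dom x y ->
    {for y, continuous (chart x)};
  mfd_inv_cont : forall x y : M, chart_dom x y ->
    {for chart x y, continuous (chart_inv x : cE E -> M)};
  mfd_trans_smooth : forall x y : M,
    smooth_on (chart x @` (chart_dom x `&` chart_dom y))
              (chart y \o chart_inv x);
  mfd_trans_holo : forall x y z : M, chart_dom x z -> chart_dom y z ->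
    forall v : cE E, 'D_(cJ v) (chart y \o chart_inv x) (chart x z) =
                     cJ ('D_v (chart y \o chart_inv x) (chart x z))
}.

(* [n] is the complex dimension. *)
Record complex_manifold (R : realType) (n : nat) := ComplexManifold {
  mfd :> charted (Cn R n);
  mfdP : is_complex_manifold mfd
}.

Definition C_charted (R : realType) : charted (C1 R) :=
  @Charted R (C1 R) (cE (C1 R)) (fun _ c => c) (fun _ c => c) (fun _ => setT).

Definition prod_charted (R : realType) (E F : cmodel R)
    (M : charted E) (N : charted F) : charted (cprod E F) :=
  @Charted R (cprod E F) (M * N)%type
    (fun x y => (chart x.1 y.1, chart x.2 y.2))
    (fun x v => (chart_inv x.1 v.1, chart_inv x.2 v.2))
    (fun x => chart_dom x.1 `*` chart_dom x.2).

Section Maps.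
Variables (R : realType) (E F : cmodel R) (M : charted E) (N : charted F).
Implicit Types (f : M -> N) (x : M).

Definition chart_rep f x : cE E -> cE F :=
  fun w => chart (f x) (f (chart_inv x w)).

(* The differential of [f] from the tangent space at [x] to that at [f x]. *)
Definition dmap f x : cE E -> cE F := fun v => 'D_v (chart_rep f x) (chart x x).

(* The next two are used for open [U] only. *)
Definition smooth_map_on (U : set M) f : Prop :=
  forall x, U x ->
    {for x, continuous f} /\ smooth_near (chart x x) (chart_rep f x).

Definition holo_map_on (U : set M) f : Prop :=
  smooth_map_on U f /\
  forall x, U x -> forall v, dmap f x (cJ v) = cJ (dmap f x v).
End Maps.

Section Fields.
Variables (R : realType) (E : cmodel R) (M : charted E).
Local Notation T := (cE E).

Definition vfield := M -> T.
Definition oneform (F : normedModType R) := M -> T -> F.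

(* Covariant derivative: [D Y x u] is the derivative at [x] of the field [Y]
   in the direction [u]; it is meaningful if [Y] is smooth near [x]. *)
Definition covop := vfield -> M -> T -> T.

Definition smooth_fun (F : normedModType R) (f : M -> F) (x : M) : Prop :=
  smooth_near (chart x x) (fun w => f (chart_inv x w)).

Definition dfun (F : normedModType R) (f : M -> F) (x : M) : T -> F :=
  fun v => 'D_v (fun w => f (chart_inv x w)) (chart x x).

(* Coordinates, with respect to the chart at [x], of a tangent vector at [y]. *)
Definition tcoord (x y : M) : T -> T :=
  fun v => 'D_v (chart x \o chart_inv y) (chart y y).

Definition vrep (X : vfield) (x : M) : T -> T :=
  fun w => tcoord x (chart_inv x w) (X (chart_inv x w)).

Definition smooth_vf (X : vfield) (x : M) : Prop :=
  smooth_near (chart x x) (vrep X x).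

(* The local vector field with constant coordinates in the chart at [x] and
   value [u] at [x]. *)
Definition ext (x : M) (u : T) : vfield :=
  fun y => 'D_u (chart y \o chart_inv x) (chart x y).

Definition lie (X Y : vfield) : vfield := fun x =>
  'D_(X x) (vrep Y x) (chart x x) - 'D_(Y x) (vrep X x) (chart x x).

(* Leibniz' rule for functions that are only smooth near [x], e.g. for
   indicator functions of neighbourhoods of [x], makes [D Y x] depend on the
   germ of [Y] at [x] only. *)
Record is_connection (D : covop) : Prop := IsConnection {
  conn_linear : forall Y x, smooth_vf Y x ->
    forall (a : R) u v, D Y x (a *: u + v) = a *: D Y x u + D Y x v;
  conn_add : forall Y Z x, smooth_vf Y x -> smooth_vf Z x ->
    forall u, D (fun y => Y y + Z y) x u = D Y x u + D Z x u;
  conn_leibniz : forall (f : M -> R^o) Y x, smooth_fun f x -> smooth_vf Y x ->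
    forall u, D (fun y => (f y : R) *: Y y) x u =
              (f x : R) *: D Y x u + (dfun f x u : R) *: Y x;
  conn_smooth : forall X Y x, smooth_vf X x -> smooth_vf Y x ->
    smooth_vf (fun y => D Y y (X y)) x
}.

Definition torsion_free (D : covop) : Prop :=
  forall X Y x, smooth_vf X x -> smooth_vf Y x ->
    D Y x (X x) - D X x (Y x) = lie X Y x.

Definition curv (D : covop) (X Y Z : vfield) : vfield := fun x =>
  D (fun y => D Z y (Y y)) x (X x) - D (fun y => D Z y (X y)) x (Y x)
  - D Z x (lie X Y x).

Definition flat (D : covop) : Prop :=
  forall X Y Z x, smooth_vf X x -> smooth_vf Y x -> smooth_vf Z x ->
    curv D X Y Z x = 0.

(* The curvature as a tensor, R_{u,v} w; any local extensions of the vectors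
   give the same value. *)
Definition Rm (D : covop) (x : M) (u v w : T) : T :=
  curv D (ext x u) (ext x v) (ext x w) x.

(* The tensor (D_u J) v. *)
Definition covJ (D : covop) (x : M) (u v : T) : T :=
  D (fun y => cJ (ext x v y)) x u - cJ (D (ext x v) x u).

Definition complex_connection (D : covop) : Prop :=
  is_connection D /\ forall x u v, covJ D x u v = 0.

Definition is_oneform (F : normedModType R) (a : oneform F) : Prop :=
  (forall x (c : R) u v, a x (c *: u + v) = c *: a x u + a x v) /\
  (forall X x, smooth_vf X x -> smooth_fun (fun y => a y (X y)) x).

Definition cproj_related (D1 D2 : covop) : Prop :=
  [/\ complex_connection D1 /\ torsion_free D1,
      complex_connection D2 /\ torsion_free D2 &
      exists2 a : oneform R^o, is_oneform a &
        forall Y x, smooth_vf Y x -> forall u,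
          D1 Y x u = D2 Y x u + (a x u : R) *: Y x + (a x (Y x) : R) *: u
                     - (a x (cJ u) : R) *: cJ (Y x)
                     - (a x (cJ (Y x)) : R) *: cJ u].

Definition special_complex (D : covop) : Prop :=
  [/\ is_connection D, torsion_free D, flat D &
      forall x u v, covJ D x u v = covJ D x v u].

Definition conical_special_complex (D : covop) (xi : vfield) : Prop :=
  [/\ special_complex D,
      (forall x, smooth_vf xi x),
      (forall x u, D xi x u = u) &
      forall X x, smooth_vf X x ->
        lie xi (fun y => cJ (X y)) x - cJ (lie xi X x) = 0].

(* nabla' = nabla - 1/2 J A, where A = nabla J. *)
Definition covprime (D : covop) : covop :=
  fun Y x u => D Y x u - 2^-1 *: cJ (covJ D x u (Y x)).
End Fields.

Section Bundle.
Variables (R : realType) (E F : cmodel R) (N : charted E) (Nb : charted F).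
Variables (act : cE (C1 R) -> N -> N) (p : N -> Nb).
Local Notation CC := (cE (C1 R)).

(* C^* is the set of nonzero elements of C; [act 0] is junk. *)

Definition over_Cstar (U : set Nb) : set (prod_charted Nb (C_charted R)) :=
  fun bc => U bc.1 /\ (bc.2 : CC) != 0.

(* Equivariant diffeomorphism z |-> (p z, triv_phi z) from p^-1(U) to
   U x C^*, with inverse [triv_inv]. *)
Record local_triv := LocalTriv {
  triv_dom : set Nb;
  triv_phi : N -> C_charted R;
  triv_inv : prod_charted Nb (C_charted R) -> N;
  triv_open : open triv_dom;
  triv_phi_neq0 : forall z, triv_dom (p z) -> triv_phi z != 0 :> CC;
  triv_phiK : forall z, triv_dom (p z) -> triv_inv (p z, triv_phi z) = z;
  triv_p_inv : forall b (c : CC), triv_dom b -> c != 0 ->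
    p (triv_inv (b, c)) = b;
  triv_phi_inv : forall b (c : CC), triv_dom b -> c != 0 ->
    triv_phi (triv_inv (b, c)) = c;
  triv_equivariant : forall z (c : CC), triv_dom (p z) -> c != 0 ->
    triv_phi (act c z) = cmul c (triv_phi z);
  triv_phi_smooth : smooth_map_on (p @^-1` triv_dom) triv_phi;
  triv_inv_smooth : smooth_map_on (over_Cstar triv_dom) triv_inv
}.

Definition holo_triv (t : local_triv) : Prop :=
  holo_map_on (p @^-1` triv_dom t) (triv_phi t) /\
  holo_map_on (over_Cstar (triv_dom t)) (triv_inv t).

Record holo_principal_bundle : Prop := HoloPrincipalBundle {
  act_one : forall z, act (cone R) z = z;
  act_mul : forall a b z, a != 0 -> b != 0 ->
    act (cmul a b) z = act a (act b z);
  act_fiber : forall c z, c != 0 -> p (act c z) = p z;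
  proj_holo : holo_map_on setT p;
  proj_triv : forall b : Nb, exists2 t, holo_triv t & triv_dom t b
}.

(* [a] is in Lie(C^* ) = C, the tangent space of C^* at 1. *)
Definition fundamental (a : CC) : vfield N :=
  fun z => dmap (fun c : C_charted R => act c z) (cone R) a.

Definition generated_by (xi : vfield N) : Prop :=
  forall z, fundamental (cone R) z = xi z /\
            fundamental (cimag R) z = cJ (xi z).

Record principal_connection10 (eta : oneform N CC) : Prop :=
  PrincipalConnection10 {
  pconn_oneform : is_oneform eta;
  pconn_fundamental : forall a z, eta z (fundamental a z) = a;
  pconn_invariant : forall c z v, c != 0 ->
    eta (act c z) (dmap (act c) z v) = eta z v;
  pconn_type10 : forall z v, eta z v = 0 -> eta z (cJ v) = 0
}.

Definition hlift_vec (eta : oneform N CC) (z : N) (u : cE F) : cE E :=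
  xget 0 [set v | dmap p z v = u /\ eta z v = 0].

Definition hlift (eta : oneform N CC) (X : vfield Nb) : vfield N :=
  fun z => hlift_vec eta z (X (p z)).

Variable nabla : covop N.

(* [Dbar] is the connection p_* (nabla'_{X~} Y~) on the base. *)
Definition induced_connection (eta : oneform N CC) (Dbar : covop Nb) : Prop :=
  is_connection Dbar /\
  forall Y z, smooth_vf Y (p z) -> forall u,
    Dbar Y (p z) u =
      dmap p z (covprime nabla (hlift eta Y) z (hlift_vec eta z u)).

Definition canonical_cproj : set (covop Nb) :=
  [set D | exists eta D0, [/\ principal_connection10 eta,
                              induced_connection eta D0 & cproj_related D D0]].

(* B = e^(2 theta J) A, with theta an argument of [triv_phi t z]; it does not
   depend on the argument chosen. *)
Definition Btensor (t : local_triv) (z : N) (u v : cE E) : cE E :=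
  let theta := get [set th : R | exists2 r : R, 0 < r &
                      triv_phi t z = (r * cos th, r * sin th)] in
  let A := covJ nabla z u v in
  cos (2 * theta) *: A + sin (2 * theta) *: cJ A.

(* The tensor induced by B on the domain of the trivialization, evaluated at
   some point of the fibre and on some lifts of the vectors; B is invariant and
   horizontal, so these choices are immaterial. *)
Definition Bbar (t : local_triv) (b : Nb) (u v : cE F) : cE F :=
  let z := xget (triv_inv t (b, cone R)) [set z | p z = b] in
  let lift w := xget 0 [set w' | dmap p z w' = w] in
  dmap p z (Btensor t z (lift u) (lift v)).
End Bundle.

Section Algebra.
Variables (R : realType) (n : nat).
Local Notation T := (cE (Cn R n)).
Implicit Types (k : T -> T -> R) (K : T -> T).

Definition tr (f : T -> T) : R :=
  \tr (lin1_mx (f : 'rV[R]_(n + n) -> 'rV[R]_(n + n))).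

Definition symm k u v : R := 2^-1 * (k u v + k v u).
Definition anti k u v : R := 2^-1 * (k u v - k v u).
Definition twistJ k u v : R := k u (cJ v).
Definition tens k K (u v w : T) : T := k u v *: K w.
Definition wedge k K (u v w : T) : T := k u w *: K v - k v w *: K u.
End Algebra.

Section Weyl.
Variables (R : realType) (n : nat) (M : complex_manifold R n) (D : covop M).
Local Notation T := (cE (Cn R n)).

Definition Ric (x : M) (v w : T) : R := tr (fun u => Rm D x u v w).

(* Here 2n is the real dimension of M. *)
Definition Rho (x : M) (u v : T) : R :=
  (n%:R + 1)^-1 *
  (Ric x u v + (n%:R - 1)^-1 * (symm (Ric x) u v - symm (Ric x) (cJ u) (cJ v))).

Definition cWeyl (x : M) (u v w : T) : T :=
  Rm D x u v w
  + tens (anti (Rho x)) id u v w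
  - tens (anti (twistJ (Rho x))) cJ u v w
  + 2^-1 *: wedge (Rho x) id u v w
  - 2^-1 *: wedge (twistJ (Rho x)) cJ u v w.
End Weyl.

(* Main.v *)
(** Let [h] be a horizontal lift from the base to [N].  Every connection of the
    canonical class is [D_X Y = p_* (nabla'_{hX} hY)] for some complex linear
    [h]: adding to [eta] a one-form pulled back from the base, that is
    adding [a(X) xi - a(JX) J xi] to the lift [hX], changes the induced
    connection by the c-projective formula with one-form [a].

    Write [nabla'_{hX} hY = h(D_X Y) + f xi + g J xi].  As [nabla' xi = id],
    [nabla' J xi = J] and [p_*[xi, hZ] = p_*[J xi, hZ] = 0], the curvature of
    [D] is the projection of that of [nabla'] plus terms that involve only
    [Q = f] and [g(X, Y) = - Q(X, JY)].  These terms have zero c-projective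
    Weyl curvature: up to sign they are built from [P = - 2 Q] like the Rho
    terms in the definition of [W], and the Rho tensor recovers [P] from them.
    Finally [nabla' = (nabla - J nabla J) / 2] is the average of two flat
    connections, so that its curvature is [- 1/4 [A, A]], whose Ricci
    contraction is [1/4 Tr (A A)] because [A_X] anticommutes with [J]. *)
Require Import Defs.
From HB Require Import structures.
From mathcomp Require Import all_boot all_order all_algebra.
From mathcomp Require Import all_classical all_reals all_analysis.
From mathcomp Require Import ring lra.
Import Order.TTheory GRing.Theory Num.Theory.
Import numFieldNormedType.Exports.
Local Open Scope classical_set_scope.
Local Open Scope ring_scope.

Set Implicit Arguments.
Unset Strict Implicit.
Unset Printing Implicit Defensive.

(** * Smooth maps between normed spaces *)

(** The one-form that relates a member of the class to the connection of [eta] is absorbed into the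
    lift, so that one curvature computation covers every member. The modified lift need not be
    horizontal; [eta] then serves to measure vertical components.

    That computation yields A at a point of the fibre, whereas [Bbar] carries a rotation e^(2 theta
    J) depending on the trivialization. As A_X anticommutes with J, moving one rotation past A_X
    inverts it, and the product of e^(2 theta J) A_X and e^(2 theta J) A_Y is A_X A_Y; the formula
    contains B only through such products. Anticommutation and the symmetry of A also give A_JX A_JY
    = A_X A_Y, the source of the type (1,1) property.

    The coefficients come from P = calB / (4 (n + 1)) - 2 Q. Here calB is symmetric and its twist by
    J is skew, so anti-symmetrization kills the former and preserves the latter, while the wedge
    terms carry a factor 1/2.

    Connections act on fields but the claim is about vectors: they are extended by the fields [ext],
    which behave linearly only near their base point. Hence the many arguments with germs. *)

Section Differentiability.
Variable R : realType.
Implicit Types E F G : normedModType R.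

Lemma differentiable_near_eq E F (f g : E -> F) x :
  (\forall y \near x, f y = g y) -> differentiable f x -> differentiable g x.
Proof.
move=> fg df.
have -> : g = f + (g - f) by apply/funext => y /=; rewrite addrC subrK.
apply: differentiableD => //.
(* The difference vanishes near [x], so its expansion there has zero linear part. *)
have h0 : (g - f) \o shift x = cst ((g - f) x) + (\0 : {linear E -> F}) +o_ 0 id.
  apply/eqaddoP => _/posnumP[e].
  have : \forall y \near 0, f (y + x) = g (y + x).
    by rewrite (near_shift x 0); near=> y; rewrite /= sub0r subrK; near: y.
  move=> fg0; near=> y.
  have gx : g x = f x by rewrite (nbhs_singleton fg).
  have gy : g (y + x) = f (y + x) by rewrite (near fg0 y).
  have -> : ((g - f) \o shift x - (cst ((g - f) x) + (\0 : {linear E -> F}))) y = 0.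
    transitivity (((g (y + x)) - f (y + x)) - ((g x - f x) + 0)) => //.
    by rewrite gy gx !subrr addr0 subrr.
  by rewrite normr0 mulr_ge0.
apply/diff_locallyP.
have c0 : continuous (\0 : {linear E -> F}) by apply: cst_continuous.
by rewrite (diff_unique c0 h0).
Unshelve. all: by end_near. Qed.

Lemma derive_comp E F G (f : E -> F) (g : F -> G) x v :
  differentiable f x -> differentiable g (f x) ->
  'D_v (g \o f) x = 'D_('D_v f x) g (f x).
Proof.
move=> df dg; rewrite !deriveE//; last exact: differentiable_comp.
by rewrite diff_comp.
Qed.

Lemma derive_linear E F (f : E -> F) x a u v : differentiable f x ->
  'D_(a *: u + v) f x = a *: 'D_u f x + 'D_v f x.
Proof. by move=> df; rewrite !deriveE// linearP. Qed.

Lemma derive_linear_map E F (f : {linear E -> F}) x v : continuous f -> 'D_v f x = f v.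
Proof.
by move=> cf; rewrite deriveE ?diff_lin//; apply: linear_differentiable.
Qed.

Lemma derive_pair E F G (f : E -> F) (g : E -> G) x v :
  differentiable f x -> differentiable g x ->
  'D_v (fun y => (f y, g y)) x = ('D_v f x, 'D_v g x).
Proof.
move=> df dg; rewrite !deriveE//; last exact: differentiable_pair.
by rewrite diff_pair.
Qed.

Lemma scale_is_bilinear F :
  bilinear_for (GRing.Scale.Law.clone _ _ *:%R _) (GRing.Scale.Law.clone _ _ *:%R _)
    (fun (a : R^o) (v : F) => (a : R) *: v).
Proof.
split=> [v|a] b x y /=; first by rewrite scalerDl scalerA.
by rewrite scalerDr !scalerA mulrC.
Qed.

Lemma diff_scale E F (f : E -> R^o) (g : E -> F) x :
  differentiable f x -> differentiable g x ->
  differentiable (fun y => (f y : R) *: g y) x /\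
  forall v, 'D_v (fun y => (f y : R) *: g y) x =
     (f x : R) *: 'D_v g x + ('D_v f x : R) *: g x.
Proof.
move=> df dg.
pose bM := bilinear_isBilinear.Build _ _ _ _ _ _ _ (@scale_is_bilinear F).
pose b : {bilinear R^o -> F -> F} := HB.pack (fun (a : R^o) (v : F) => (a : R) *: v) bM.
have cb : continuous (fun p : R^o * F => b p.1 p.2).
  by move=> p; apply: (@scale_continuous R F p).
have dp : differentiable (fun y => (f y, g y)) x by exact: differentiable_pair.
have db := differentiable_bilin (f x, g x) cb.
split.
  by have := @differentiable_comp _ _ _ _ (fun y => (f y, g y)) (fun p => b p.1 p.2) x dp db.
move=> v; have := @derive_comp _ _ _ (fun y => (f y, g y)) (fun p => b p.1 p.2) x v dp db.
rewrite derive_pair// => e; rewrite [LHS]e deriveE// diff_bilin//.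
Qed.
End Differentiability.

(** A form of finite dimensionality for abstract normed spaces that passes to products: finitely
    many spanning vectors with continuous linear coordinates. Independence of the vectors is not
    part of it. *)
Definition fin_frame (R : realType) (F : normedModType R) : Prop :=
  exists (I : finType) (e : I -> F) (c : I -> {linear F -> R^o}),
    (forall i, continuous (c i)) /\
    (forall v, v = \sum_i (c i v : R) *: e i).

Section Frames.
Variable R : realType.
Implicit Types E F G : normedModType R.

Lemma fin_frame_rV n : fin_frame ('rV[R]_n : normedModType R).
Proof.
exists 'I_n, (fun i => delta_mx 0 i).
have lc (i : 'I_n) : linear (fun v : 'rV[R]_n => v 0 i : R^o).
  by move=> a u v; rewrite !mxE.
pose L i : {linear 'rV[R]_n -> R^o} := HB.pack (fun v : 'rV[R]_n => v 0 i : R^o)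
  (GRing.isLinear.Build _ _ _ _ _ (lc i)).
exists L; split; last by move=> v; exact: row_sum_delta.
move=> i; apply: coord_continuous.
Qed.

Lemma fin_frame_R : fin_frame (R^o : normedModType R).
Proof.
exists 'I_1, (fun=> 1), (fun=> idfun); split; first by move=> i x; exact: cvg_id.
by move=> v; rewrite big_ord1 /= /GRing.scale /= mulr1.
Qed.

Lemma fin_frame_prod F G : fin_frame F -> fin_frame G ->
  fin_frame (F * G)%type.
Proof.
move=> [I [e [c [cc ce]]]] [J [e' [c' [cc' ce']]]].
pose h (k : I + J) (v : F * G) : R^o :=
  match k with inl i => c i v.1 | inr j => c' j v.2 end.
have lh k : linear (h k).
  by case: k => i a u v /=; rewrite linearP.
exists (I + J)%type, (fun k => match k with inl i => (e i, 0) | inr j => (0, e' j) end).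
pose L k : {linear (F * G)%type -> R^o} :=
  HB.pack (h k) (GRing.isLinear.Build _ _ _ _ _ (lh k)).
exists L; split.
  case=> i v /=.
    by apply: (@continuous_comp _ _ _ fst (c i)); [exact: cvg_fst|exact: cc].
  by apply: (@continuous_comp _ _ _ snd (c' i)); [exact: cvg_snd|exact: cc'].
move=> [u v]; rewrite big_sumType /=.
have s1 (r : seq I) : \sum_(i <- r) (c i u : R) *: (e i, 0 : G) =
    (\sum_(i <- r) (c i u : R) *: e i, 0).
  elim/big_rec2: _ => // i y1 y2 _ ->.
    rewrite -[LHS]/((c i u : R) *: e i + y1, (c i u : R) *: (0 : G) + 0).
    by rewrite scaler0 addr0.
have s2 (r : seq J) : \sum_(i <- r) (c' i v : R) *: (0 : F, e' i) =
    (0, \sum_(i <- r) (c' i v : R) *: e' i).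
  elim/big_rec2: _ => // i y1 y2 _ ->.
    rewrite -[LHS]/((c' i v : R) *: (0 : F) + 0, (c' i v : R) *: e' i + y1).
    by rewrite scaler0 addr0.
rewrite s1 s2 -ce -ce' -[RHS]/(u + 0, 0 + v).
by rewrite addr0 add0r.
Qed.

Lemma linear_frame_continuous F G (f : {linear F -> G}) : fin_frame F -> continuous f.
Proof.
move=> [I [e [c [cc ce]]]].
have -> : f = (fun v => \sum_i (c i v : R) *: f (e i)) :> (F -> G).
  by apply/funext => v; rewrite [in LHS](ce v) linear_sum; apply: eq_bigr => i _; rewrite linearZ.
suff H (s : seq I) : continuous (fun v => \sum_(i <- s) (c i v : R) *: f (e i)).
  exact: H.
elim: s => [|i s IH] x.
  under eq_fun do rewrite big_nil.
  exact: cst_continuous.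
under eq_fun do rewrite big_cons.
apply: (@continuousD _ _ _ (fun v => (c i v : R) *: f (e i))); last exact: IH.
by apply: (@continuousZ _ _ _ (c i) (fun=> f (e i))); [exact: cc|exact: cst_continuous].
Qed.
End Frames.

(** * Maps of class C^k on open sets *)

Section Ck.
Variable R : realType.
Implicit Types E F G : normedModType R.

Lemma Ck_ext E F k (U : set E) (f g : E -> F) : open U ->
  (forall x, U x -> f x = g x) -> Ck_on k U f -> Ck_on k U g.
Proof.
move=> oU; elim: k f g => [|k IH] f g fg /=.
  move=> cf x Ux; have fgx : \forall y \near x, f y = g y.
    by apply: filterS (open_nbhs_nbhs (conj oU Ux)) => y; exact: fg.
  have cfx : f @ x --> f x by exact: cf.
  by rewrite (fg x Ux) in cfx; exact: cvg_trans (near_eq_cvg fgx) cfx.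
have fgx x : U x -> \forall y \near x, f y = g y.
  by move=> Ux; apply: filterS (open_nbhs_nbhs (conj oU Ux)) => y; exact: fg.
move=> [df cf]; split.
  by move=> x Ux; apply: differentiable_near_eq (df x Ux); exact: fgx.
by move=> v; apply: IH (cf v) => x Ux; apply: near_eq_derive; exact: fgx.
Qed.

Lemma Ck_sub E F k (U V : set E) (f : E -> F) : V `<=` U ->
  Ck_on k U f -> Ck_on k V f.
Proof.
move=> VU; elim: k f => [|k IH] f /=; first by move=> cf x /VU; exact: cf.
by move=> [df cf]; split=> [x /VU|v]; [exact: df|exact: IH].
Qed.

Lemma CkS E F k (U : set E) (f : E -> F) : Ck_on k.+1 U f -> Ck_on k U f.
Proof.
elim: k f => [|k IH] f.
  by move=> [df _] x Ux; apply: differentiable_continuous; exact: df.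
by move=> [df cf]; split => // v; apply: IH.
Qed.

Lemma Ck_cst E F k (U : set E) (a : F) : open U -> Ck_on k U (fun _ => a).
Proof.
move=> oU; elim: k a => [|k IH] a /=; first by move=> x _; exact: cst_continuous.
split=> [x _|v]; first exact: differentiable_cst.
by apply: Ck_ext (IH 0) => // x _; rewrite derive_cst.
Qed.

Lemma CkD E F k (U : set E) (f g : E -> F) : open U ->
  Ck_on k U f -> Ck_on k U g -> Ck_on k U (fun x => f x + g x).
Proof.
move=> oU; elim: k f g => [|k IH] f g /=.
  by move=> cf cg x Ux; apply: (@continuousD _ _ _ f g); [exact: cf|exact: cg].
move=> [df cf] [dg cg]; split=> [x Ux|v].
  by apply: (@differentiableD _ _ _ f g); [exact: df|exact: dg].
apply: Ck_ext (IH _ _ (cf v) (cg v)) => // x Ux.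
by rewrite -[RHS]/('D_v (f + g) x) deriveD//; apply: diff_derivable; auto.
Qed.

Lemma Ck_linear E F G k (U : set E) (f : E -> F) (L : {linear F -> G}) : open U ->
  continuous L -> Ck_on k U f -> Ck_on k U (fun x => L (f x)).
Proof.
move=> oU cL; elim: k f => [|k IH] f /=.
  by move=> cf x Ux; apply: (@continuous_comp _ _ _ f L); [exact: cf|exact: cL].
have dL y : differentiable L y by exact: linear_differentiable.
move=> [df cf]; split=> [x Ux|v].
  by apply: (@differentiable_comp _ _ _ _ f L); [exact: df|].
apply: Ck_ext (IH _ (cf v)) => // x Ux.
by rewrite -[RHS]/('D_v (L \o f) x) (derive_comp _ (df x Ux) (dL _)) derive_linear_map.
Qed.

Lemma Ck_scale E F k (U : set E) (f : E -> R^o) (g : E -> F) : open U ->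
  Ck_on k U f -> Ck_on k U g -> Ck_on k U (fun x => (f x : R) *: g x).
Proof.
move=> oU; elim: k f g => [|k IH] f g.
  by move=> /= cf cg x Ux; apply: (@continuousZ _ _ _ f g x); [exact: cf|exact: cg].
move=> Cf Cg; have [df cf] := Cf; have [dg cg] := Cg; split=> [x Ux|v].
  by case: (diff_scale (df x Ux) (dg x Ux)).
apply: Ck_ext (CkD oU (IH _ _ (CkS Cf) (cg v)) (IH _ _ (cf v) (CkS Cg))) => // x Ux.
by have [_ ->] := diff_scale (df x Ux) (dg x Ux).
Qed.

Lemma Ck_pair E F G k (U : set E) (f : E -> F) (g : E -> G) : open U ->
  Ck_on k U f -> Ck_on k U g -> Ck_on k U (fun x => (f x, g x)).
Proof.
move=> oU; elim: k f g => [|k IH] f g /=.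
  by move=> cf cg x Ux; apply: cvg_pair; [exact: cf|exact: cg].
move=> [df cf] [dg cg]; split=> [x Ux|v].
  by apply: differentiable_pair; [exact: df|exact: dg].
apply: Ck_ext (IH _ _ (cf v) (cg v)) => // x Ux.
by rewrite (derive_pair _ (df x Ux) (dg x Ux)).
Qed.

Lemma Ck_sum E F k (U : set E) (I : finType) (f : I -> E -> F) : open U ->
  (forall i, Ck_on k U (f i)) -> Ck_on k U (fun x => \sum_i f i x).
Proof.
move=> oU cf; have : forall s : seq I, Ck_on k U (fun x => \sum_(i <- s) f i x).
  elim=> [|i s IH].
    by apply: Ck_ext (@Ck_cst _ _ k U (0 : F) oU) => // x _; rewrite big_nil.
  by apply: Ck_ext (CkD oU (cf i) IH) => // x _; rewrite big_cons.
by move=> /(_ (index_enum I)).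
Qed.

Lemma smooth_on_derive E F (U : set E) (f : E -> F) v :
  smooth_on U f -> smooth_on U (fun x => 'D_v f x).
Proof. by move=> sf k; have [_] := sf k.+1; exact. Qed.

(** [Ck_on] speaks of derivatives in constant directions only. The frame turns a derivative in a
    direction that varies with the point into a combination of such derivatives. *)
Lemma derive_frame E F G (I : finType) (e : I -> F) (c : I -> {linear F -> R^o})
   (f : E -> F) (g : F -> G) x v :
  (forall v, v = \sum_i (c i v : R) *: e i) ->
  differentiable g (f x) ->
  'D_v g (f x) = \sum_i (c i v : R) *: 'D_(e i) g (f x).
Proof.
move=> ce dg; rewrite deriveE// [in LHS](ce v) linear_sum.
by apply: eq_bigr => i _; rewrite linearZ deriveE.
Qed.

(** Induction on [k] with both maps smooth: by the chain rule and the frame, a derivative of the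
    composite is a sum of coordinates of 'D_v f times composites of [f] with the again smooth maps
    'D_(e i) g. *)
Lemma Ck_comp E F G k (U : set E) (V : set F) (f : E -> F) (g : F -> G) :
  fin_frame F -> open U -> open V -> (forall x, U x -> V (f x)) ->
  smooth_on U f -> smooth_on V g -> Ck_on k U (g \o f).
Proof.
move=> [I [e [c [cc ce]]]] oU oV UV sf; elim: k g => [|k IH] g sg.
  move=> x Ux; apply: continuous_comp; first exact: (sf 0%N).
  by apply: (sg 0%N); exact: UV.
have [df cf] := sf 1%N; have [dg cg] := sg 1%N.
split=> [x Ux|v].
  by apply: differentiable_comp; [exact: df|apply: dg; exact: UV].
apply: (@Ck_ext _ _ _ _
   (fun x => \sum_i (c i ('D_v f x) : R) *: 'D_(e i) g (f x))) => //.
  move=> x Ux; rewrite (derive_comp _ (df x Ux) (dg _ (UV _ Ux))).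
  by symmetry; apply: derive_frame => //; apply: dg; exact: UV.
apply: Ck_sum => // i; apply: Ck_scale => //.
  by apply: Ck_linear => //; exact: smooth_on_derive.
by apply: (IH (fun y => 'D_(e i) g y)); exact: smooth_on_derive.
Qed.
End Ck.

(** * Germs of smooth maps *)

Section SmoothNear.
Variable R : realType.
Implicit Types E F G : normedModType R.

Lemma smooth_near_ext E F (x : E) (f g : E -> F) :
  (\forall y \near x, f y = g y) -> smooth_near x f -> smooth_near x g.
Proof.
rewrite -near_nbhs nearE nbhsE => -[V [oV Vx] fg] [U [oU Ux sf]].
exists (U `&` V); split=> [||k]; [exact: openI|by []|].
apply: (@Ck_ext _ _ _ _ _ f); [exact: openI|by move=> y [_ /fg]|].
by apply: Ck_sub (sf k) => y [].
Qed.

Lemma smooth_near_near E F (x : E) (f : E -> F) : smooth_near x f ->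
  \forall y \near x, smooth_near y f.
Proof.
move=> [U [oU Ux sf]]; apply: filterS (open_nbhs_nbhs (conj oU Ux)) => y Uy.
by exists U.
Qed.

Lemma smooth_near_diff E F (x : E) (f : E -> F) : smooth_near x f -> differentiable f x.
Proof. by move=> [U [oU Ux sf]]; have [df _] := sf 1%N; exact: df. Qed.

Lemma smooth_near_cont E F (x : E) (f : E -> F) : smooth_near x f -> {for x, continuous f}.
Proof. by move=> sf; apply: differentiable_continuous; exact: smooth_near_diff. Qed.

Lemma smooth_near_derive E F (x : E) (f : E -> F) v : smooth_near x f ->
  smooth_near x (fun y => 'D_v f y).
Proof.
by move=> [U [oU Ux sf]]; exists U; split=> //; apply: smooth_on_derive.
Qed.

Lemma smooth_near_cst E F (x : E) (a : F) : smooth_near x (fun _ : E => a).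
Proof. by exists setT; split=> //; [exact: openT|move=> k; apply: Ck_cst; exact: openT]. Qed.

Lemma smooth_near2 E F G (H : normedModType R) (x : E) (f : E -> F) (g : E -> G) (h : E -> H) :
  (forall k (U : set E), open U -> Ck_on k U f -> Ck_on k U g -> Ck_on k U h) ->
  smooth_near x f -> smooth_near x g -> smooth_near x h.
Proof.
move=> fgh [U [oU Ux sf]] [V [oV Vx sg]]; exists (U `&` V).
split=> [||k]; [exact: openI|by []|].
by apply: fgh; [exact: openI|apply: Ck_sub (sf k) => y []|apply: Ck_sub (sg k) => y []].
Qed.

Lemma smooth_nearD E F (x : E) (f g : E -> F) : smooth_near x f -> smooth_near x g ->
  smooth_near x (fun y => f y + g y).
Proof. by apply: smooth_near2 => k U oU; exact: CkD. Qed.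

Lemma smooth_near_pair E F G (x : E) (f : E -> F) (g : E -> G) :
  smooth_near x f -> smooth_near x g -> smooth_near x (fun y => (f y, g y)).
Proof. by apply: smooth_near2 => k U oU; exact: Ck_pair. Qed.

Lemma smooth_near_scale E F (x : E) (f : E -> R^o) (g : E -> F) :
  smooth_near x f -> smooth_near x g -> smooth_near x (fun y => (f y : R) *: g y).
Proof. by apply: smooth_near2 => k U oU; exact: Ck_scale. Qed.

Lemma smooth_near_linear E F G (x : E) (f : E -> F) (L : {linear F -> G}) : continuous L ->
  smooth_near x f -> smooth_near x (fun y => L (f y)).
Proof. by move=> cL sf; apply: smooth_near2 (sf) (sf) => k U oU Cf _; exact: Ck_linear. Qed.

Lemma smooth_near_sum E F (I : finType) (x : E) (f : I -> E -> F) :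
  (forall i, smooth_near x (f i)) -> smooth_near x (fun y => \sum_i f i y).
Proof.
move=> cf; have : forall s : seq I, smooth_near x (fun y => \sum_(i <- s) f i y).
  elim=> [|i s IH].
    have -> : (fun y => \sum_(i <- [::]) f i y) = (fun=> 0).
      by apply/funext => y; rewrite big_nil.
    exact: smooth_near_cst.
  have -> : (fun y => \sum_(j <- i :: s) f j y) = (fun y => f i y + \sum_(j <- s) f j y).
    by apply/funext => y; rewrite big_cons.
  exact: smooth_nearD.
by move=> /(_ (index_enum I)).
Qed.

Lemma smooth_near_comp E F G (x : E) (f : E -> F) (g : F -> G) : fin_frame F ->
  smooth_near x f -> smooth_near (f x) g -> smooth_near x (g \o f).
Proof.
move=> fF sf0 [V [oV Vx sg]]; have [U [oU Ux sf]] := sf0.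
exists (U `&` f @^-1` V); split => //.
  rewrite openE => y [Uy Vy]; rewrite /interior; apply: filterI.
    exact: open_nbhs_nbhs.
  apply: (sf 0%N y Uy); exact: open_nbhs_nbhs.
have oW : open (U `&` f @^-1` V).
  rewrite openE => y [Uy Vy]; rewrite /interior; apply: filterI.
    exact: open_nbhs_nbhs.
  apply: (sf 0%N y Uy); exact: open_nbhs_nbhs.
move=> k; apply: (@Ck_comp _ _ _ _ _ _ V) => // [y []//|j].
by apply: Ck_sub (sf j) => y [].
Qed.

Lemma smooth_near_dapp E F G (x : E) (f : E -> F) (w : E -> F) (g : F -> G) : fin_frame F ->
  smooth_near x f -> smooth_near x w -> smooth_near (f x) g ->
  smooth_near x (fun y => 'D_(w y) g (f y)).
Proof.
move=> fF sf sw sg; have [I [e [c [cc ce]]]] := fF.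
have cf : f @ x --> f x by exact: smooth_near_cont.
have sgf : \forall y \near x, smooth_near (f y) g.
  exact: (cf _ (smooth_near_near sg)).
apply: (@smooth_near_ext _ _ _ (fun y => \sum_i (c i (w y) : R) *: 'D_(e i) g (f y))).
  near=> y; symmetry; apply: derive_frame => //; apply: smooth_near_diff.
  by near: y.
apply: smooth_near_sum => i; apply: smooth_near_scale.
  by apply: (@smooth_near_linear _ _ _ x w (c i)).
by apply: (@smooth_near_comp _ _ _ x f (fun z => 'D_(e i) g z)) => //; exact: smooth_near_derive.
Unshelve. all: by end_near. Qed.
End SmoothNear.

(** * Symmetry of second derivatives *)

Section Schwarz.
Variable R : realType.
Implicit Types E F : normedModType R.

Lemma subr_interchange (V : zmodType) (p q r s : V) : p - q - (r - s) = p - r - (q - s).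
Proof. by rewrite !opprB addrACA [RHS]addrACA [- r - q]addrC. Qed.

Lemma dist_le_halves (a b c e : R) :
  `|a - c| < e / 2 -> `|b - c| < e / 2 -> `|a - b| <= e.
Proof.
move=> ac bc; rewrite distrC in bc.
by rewrite ltW// (le_lt_trans (ler_distD c _ _))// [ltRHS]splitr ltrD.
Qed.

Lemma differentiable_id E (x : E) : differentiable id x.
Proof. by have [] := is_diff_id x. Qed.

Lemma MVT_line E (f : E -> R^o) (a u : E) (t : R) : 0 < t ->
  (forall s : R, 0 <= s <= t -> differentiable f (a + s *: u)) ->
  exists2 s : R, 0 <= s <= t & f (a + t *: u) - f a = t * 'D_u f (a + s *: u).
Proof.
move=> t0 df.
pose g (s : R) : R := f (a + s *: u).
have dl (s : R) : differentiable (fun s : R^o => a + (s : R) *: u : E) s /\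
    'D_(1 : R^o) (fun s : R^o => a + (s : R) *: u : E) s = u.
  have [d e] := @diff_scale R R^o E id (fun=> u) s (@differentiable_id _ _)
    (differentiable_cst _ _).
  split; first by apply: (@differentiableD _ _ _ (cst a)).
  rewrite -[LHS]/('D_(1 : R^o) (cst a + (fun s : R^o => (s : R) *: u : E)) s).
  rewrite deriveD; last exact: diff_derivable.
    by rewrite e !derive_cst derive_id scaler0 scale1r !add0r.
  exact: derivable_cst.
have dg (s : R) : 0 <= s <= t -> is_derive s 1 g ('D_u f (a + s *: u)).
  move=> st; have [d e] := dl s.
  have dc := differentiable_comp d (df s st).
  apply: DeriveDef; first exact: diff_derivable.
  by rewrite -[LHS]/('D_(1 : R^o) (f \o (fun s : R^o => a + (s : R) *: u : E)) s)
    derive_comp ?e//; exact: df.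
have [|||s sI e] := @MVT_segment R g (fun s => 'D_u f (a + s *: u)) 0 t.
- exact: ltW.
- by move=> s; rewrite in_itv /= => /andP[s0 st]; apply: dg; rewrite !ltW.
- apply: derivable_within_continuous => s; rewrite in_itv /= => st.
  by have [] := dg s st.
- exists s; first by move: sI; rewrite in_itv.
  move: e; rewrite subr0 /g scale0r addr0 => ->; exact: mulrC.
Qed.

(** The mean value theorem applied twice: along [u] to the increment of [f] by [t *: v], then along
    [v] to 'D_u f. *)
Lemma second_difference E (f : E -> R^o) (x u v : E) (t : R) : 0 < t ->
  (forall s s' : R, 0 <= s <= t -> 0 <= s' <= t ->
     smooth_near (x + s *: u + s' *: v) f) ->
  exists s s' : R, [/\ 0 <= s <= t, 0 <= s' <= t &
    f (x + t *: u + t *: v) - f (x + t *: u) - (f (x + t *: v) - f x) =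
    t ^+ 2 * 'D_v (fun y => 'D_u f y) (x + s *: u + s' *: v)].
Proof.
move=> t0 sf.
have tt : 0 <= t <= t by rewrite ltW/=.
have t00 : 0 <= (0 : R) <= t by rewrite lexx ltW.
pose phi (y : E) : R^o := f (y + t *: v) - f y.
have dsh (s : R) : 0 <= s <= t ->
    differentiable phi (x + s *: u) /\
    'D_u phi (x + s *: u) =
      'D_u f (x + s *: u + t *: v) - 'D_u f (x + s *: u).
  move=> st.
  have d1 : differentiable f (x + s *: u + t *: v) by apply: smooth_near_diff; exact: sf.
  have d2 : differentiable f (x + s *: u).
    by have := smooth_near_diff (sf s 0 st t00); rewrite scale0r addr0.
  have dt : differentiable (fun y : E => y + t *: v) (x + s *: u).
    by apply: (@differentiableD _ _ _ id (cst (t *: v))) => //; exact: differentiable_cst.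
  have dc : differentiable (f \o (fun y => y + t *: v)) (x + s *: u).
    exact: differentiable_comp.
  split; first exact: (differentiableB dc d2).
  rewrite -[LHS]/('D_u (f \o (fun y => y + t *: v) - f) (x + s *: u)).
  have et : 'D_u (fun y : E => y + t *: v) (x + s *: u) = u.
    rewrite -[LHS]/('D_u (id + cst (t *: v)) (x + s *: u)).
    by rewrite deriveD ?derive_id ?derive_cst ?addr0//; exact: derivable_cst.
  rewrite deriveB; [|exact: diff_derivable|exact: diff_derivable].
  by rewrite (derive_comp _ dt d1) et.
have [|s st e1] := @MVT_line E phi x u t t0; first by move=> s /dsh[].
have [_ e2] := dsh s st.
have [|s' st' e3] := @MVT_line E (fun y => 'D_u f y) (x + s *: u) v t t0.
  by move=> s' st'; apply/smooth_near_diff/smooth_near_derive; exact: sf.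
exists s, s'; split => //.
by rewrite expr2 -mulrA -e3 -e2 -e1.
Qed.

(** The second difference is symmetric in [u] and [v], so the two mixed derivatives agree at
    suitable, generally different, points of a small parallelogram. Continuity of both at [x] then
    bounds their difference by any positive [e]. *)
Lemma schwarz_scalar E (f : E -> R^o) (x u v : E) : smooth_near x f ->
  'D_v (fun y => 'D_u f y) x = 'D_u (fun y => 'D_v f y) x.
Proof.
move=> sf; apply/eqP; rewrite -subr_eq0 -normr_le0; apply/ler_addgt0Pr => e e0; rewrite add0r.
have e20 : 0 < e / 2 by rewrite divr_gt0.
have n1 := smooth_near_near sf.
have c1 : {for x, continuous (fun y => 'D_v (fun y => 'D_u f y) y : R^o)}.
  by apply/smooth_near_cont/smooth_near_derive/smooth_near_derive.
have c2 : {for x, continuous (fun y => 'D_u (fun y => 'D_v f y) y : R^o)}.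
  by apply/smooth_near_cont/smooth_near_derive/smooth_near_derive.
have {}c1 := (@cvgr_dist_lt _ _ _ _ (nbhs_filter x) _ _ c1 _ e20).
have {}c2 := (@cvgr_dist_lt _ _ _ _ (nbhs_filter x) _ _ c2 _ e20).
have n2 := @filterI _ (nbhs x) (nbhs_filter x) _ _ n1 (@filterI _ (nbhs x) (nbhs_filter x) _ _ c1 c2).
have [r r0 br] := proj1 (nbhs_ballP x _) n2.
pose d : R := `|u| + `|v| + 1.
(* With this scale every x + s u + s' v with s, s' in [0, t] is at distance at most t d = r / 2 from
   [x]; the summand 1 in [d] makes it positive. *)
pose t : R := (r : R) / d / 2.
have d0 : 0 < d by rewrite ltr_wpDl// addr_ge0.
have t0 : 0 < t by rewrite !divr_gt0.
have inb s s' : 0 <= s <= t -> 0 <= s' <= t -> ball x r (x + s *: u + s' *: v).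
  move=> /andP[s0 st] /andP[s0' st'].
  rewrite -ball_normE /ball_ /= -addrA opprD addNKr normrN.
  apply: (le_lt_trans (ler_normD _ _)).
  rewrite !normrZ !ger0_norm//.
  have : s * `|u| + s' * `|v| <= t * d.
    rewrite /d 2!mulrDr mulr1 -[leLHS]addr0.
    by apply: lerD; [apply: lerD; exact: ler_wpM2r|exact: ltW].
  move=> /le_lt_trans; apply.
  by rewrite /t mulrAC divfK ?gt_eqF// ltr_pdivrMr// mulr_natr mulr2n ltrDl.
have [|s1 [s1' [h1 h1' e1]]] := @second_difference E f x u v t t0.
  by move=> s s' h h'; have [] := br _ (inb _ _ h h').
have [|s2 [s2' [h2 h2' e2]]] := @second_difference E f x v u t t0.
  move=> s s' h h'; rewrite addrAC; by have [] := br _ (inb _ _ h' h).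
have [_ [b1 _]] := br _ (inb _ _ h1 h1').
have [_ [_ b2]] := br _ (inb _ _ h2' h2).
have xt : x + t *: v + t *: u = x + t *: u + t *: v by rewrite addrAC.
have xs : x + s2 *: v + s2' *: u = x + s2' *: u + s2 *: v by rewrite addrAC.
rewrite xt xs subr_interchange in e2.
have E12 : 'D_v (fun y => 'D_u f y) (x + s1 *: u + s1' *: v) =
           'D_u (fun y => 'D_v f y) (x + s2' *: u + s2 *: v) :> R.
  have tt : t ^+ 2 != 0 by rewrite expf_neq0 ?gt_eqF.
  exact: (mulfI tt (etrans (esym e1) e2)).
rewrite E12 in b1.
exact: dist_le_halves b1 b2.
Qed.

Lemma schwarz E F (f : E -> F) (x u v : E) : fin_frame F -> smooth_near x f ->
  'D_v (fun y => 'D_u f y) x = 'D_u (fun y => 'D_v f y) x.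
Proof.
move=> [I [e [c [cc ce]]]] sf.
suff S i : c i ('D_v (fun y => 'D_u f y) x) = c i ('D_u (fun y => 'D_v f y) x).
  apply: (etrans (ce _)); apply: (etrans _ (esym (ce _))).
  by apply: eq_bigr => i _; rewrite S.
have H w w' : 'D_w (fun y => 'D_w' (c i \o f) y) x = c i ('D_w (fun y => 'D_w' f y) x).
  have sw : smooth_near x (fun y => 'D_w' f y) by exact: smooth_near_derive.
  rewrite -[RHS](derive_linear_map ('D_w' f x) ('D_w (fun y => 'D_w' f y) x) (cc i)).
  rewrite -(@derive_comp _ _ _ _ (fun y => 'D_w' f y) (c i) x w (smooth_near_diff sw)).
    apply: near_eq_derive; near=> y; rewrite derive_comp.
    - by rewrite derive_linear_map.
    - by apply: smooth_near_diff; near: y; exact: smooth_near_near.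
    - exact: linear_differentiable.
  exact: linear_differentiable.
rewrite -!H; apply: schwarz_scalar.
exact: smooth_near_linear.
Unshelve. all: by end_near. Qed.
End Schwarz.

Lemma nearI (T : topologicalType) (x : T) (P Q : T -> Prop) :
  nbhs x P -> nbhs x Q -> nbhs x (fun y => P y /\ Q y).
Proof. exact: filterI. Qed.

(** * Vector fields on complex manifolds *)

(** A [cmodel] imposes no law on [cJ]. This collects what is used of C^n; linearity is existential
    because [cJ] is a bare function. *)
Record cmodel_ok (R : realType) (E : cmodel R) : Prop := CmodelOk {
  model_frame : fin_frame (cE E);
  model_J : exists L : {linear cE E -> cE E}, forall v, cJ v = L v;
  model_JJ : forall v : cE E, cJ (cJ v) = - v
}.

Section ModelJ.
Variables (R : realType) (E : cmodel R) (okE : cmodel_ok E).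

Lemma cJP (a : R) (u v : cE E) : cJ (a *: u + v) = a *: cJ u + cJ v.
Proof. by have [L e] := model_J okE; rewrite !e linearP. Qed.

Lemma cJD (u v : cE E) : cJ (u + v) = cJ u + cJ v.
Proof. by have [L e] := model_J okE; rewrite !e linearD. Qed.

Lemma cJN (u : cE E) : cJ (- u) = - cJ u.
Proof. by have [L e] := model_J okE; rewrite !e linearN. Qed.

Lemma cJB (u v : cE E) : cJ (u - v) = cJ u - cJ v.
Proof. by rewrite cJD cJN. Qed.

Lemma cJZ (a : R) (u : cE E) : cJ (a *: u) = a *: cJ u.
Proof. by have [L e] := model_J okE; rewrite !e linearZ. Qed.

Lemma cJ0 : cJ (0 : cE E) = 0.
Proof. by have [L e] := model_J okE; rewrite e linear0. Qed.

Lemma smooth_near_cJ (F : normedModType R) (x : F) (f : F -> cE E) :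
  smooth_near x f -> smooth_near x (fun y => cJ (f y)).
Proof.
have [L e] := model_J okE; move=> sf.
have -> : (fun y => cJ (f y)) = (fun y => L (f y)) by apply/funext => y; rewrite e.
have cL : continuous L := linear_frame_continuous (model_frame okE).
exact: (smooth_near_linear cL sf).
Qed.

End ModelJ.

Section Manifold.
Variables (R : realType) (E : cmodel R) (okE : cmodel_ok E).
Variables (M : charted E) (hM : is_complex_manifold M).
Let T : normedModType R := cE E.
Implicit Types (x y z : M) (X Y Z : vfield M).

Lemma near_dom x z : chart_dom x z -> \forall y \near z, chart_dom x y.
Proof. by move=> xz; exact: (open_nbhs_nbhs (conj (mfd_dom_open hM x) xz)). Qed.

Lemma near_chart_inv x z (P : M -> Prop) : chart_dom x z ->
  (\forall y \near z, P y) -> \forall w \near chart x z, P (chart_inv x w).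
Proof.
move=> xz nP; have c := mfd_inv_cont hM xz.
have c' : (chart_inv x : cE E -> M) @ chart x z --> chart_inv x (chart x z) by exact: c.
by rewrite (mfd_chartK hM xz) in c'; exact: (c' _ nP).
Qed.

Lemma near_chart x z (P : cE E -> Prop) : chart_dom x z ->
  (\forall w \near chart x z, P w) -> \forall y \near z, P (chart x y).
Proof.
move=> xz nP; have c' : chart x @ z --> chart x z by exact: (mfd_chart_cont hM xz).
exact: (c' _ nP).
Qed.

Lemma near_chart_invK x z : chart_dom x z ->
  \forall w \near chart x z, chart x (chart_inv x w) = w.
Proof.
move=> xz.
have : nbhs (chart x z) (chart x @` chart_dom x).
  by apply: open_nbhs_nbhs; split; [exact: (mfd_img_open hM)|exists z].
by move=> n; apply: filterS n => _ [y xy <-]; rewrite (mfd_chartK hM xy).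
Qed.

(** The transition function of the tangent bundle at [z], from the chart at [x] to that at [y]. Both
    [tcoord] and [ext] are instances, so the cocycle rule [dtrans_comp] serves for both. *)
Definition dtrans x y z : T -> T :=
  fun v => 'D_v (chart y \o chart_inv x) (chart x z).

Lemma trans_smooth x y z : chart_dom x z -> chart_dom y z ->
  smooth_near (chart x z) (chart y \o chart_inv x : T -> T).
Proof.
move=> xz yz; exists (chart x @` (chart_dom x `&` chart_dom y)); split.
- rewrite openE => _ [z' [xz' yz'] <-]; rewrite /interior.
  have n1 := near_chart_invK xz'.
  have n2 := near_chart_inv xz' (nearI (near_dom xz') (near_dom yz')).
  apply: filterS (nearI n1 n2) => w [e [d1 d2]].
  by exists (chart_inv x w).
- by exists z.
- exact: (mfd_trans_smooth hM).
Qed.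

Lemma trans_diff x y z : chart_dom x z -> chart_dom y z ->
  differentiable (chart y \o chart_inv x : T -> T) (chart x z).
Proof. by move=> xz yz; apply: smooth_near_diff; exact: trans_smooth. Qed.

Lemma dtransP x y z : chart_dom x z -> chart_dom y z ->
  forall (a : R) u v, dtrans x y z (a *: u + v) = a *: dtrans x y z u + dtrans x y z v.
Proof. by move=> xz yz a u v; apply: derive_linear; exact: trans_diff. Qed.

Lemma dtransJ x y z v : chart_dom x z -> chart_dom y z ->
  dtrans x y z (cJ v) = cJ (dtrans x y z v).
Proof. by move=> xz yz; exact: (mfd_trans_holo hM). Qed.

Lemma dtrans_comp x y y' z v : chart_dom x z -> chart_dom y z -> chart_dom y' z ->
  dtrans y y' z (dtrans x y z v) = dtrans x y' z v.
Proof.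
move=> xz yz y'z; rewrite /dtrans.
have e : (chart y \o chart_inv x) (chart x z) = chart y z :> T.
  by rewrite /= (mfd_chartK hM xz).
have d1 := trans_diff xz yz.
have d2 : differentiable (chart y' \o chart_inv y : T -> T) ((chart y \o chart_inv x) (chart x z)).
  by rewrite e; exact: trans_diff.
rewrite -{1}e -(derive_comp v d1 d2); apply: near_eq_derive.
have n := near_chart_inv xz (near_dom yz).
by apply: filterS n => w yw /=; rewrite (mfd_chartK hM yw).
Qed.

Lemma dtrans_id x z v : chart_dom x z -> dtrans x x z v = v.
Proof.
move=> xz; rewrite /dtrans -[RHS](derive_id (chart x z) v).
by apply: near_eq_derive; exact: near_chart_invK.
Qed.

Lemma tcoordE x y v : tcoord x y v = dtrans y x y v. Proof. by []. Qed.

Lemma extE x y (u : T) : ext x u y = dtrans x y y u. Proof. by []. Qed.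

Lemma vrepE X x y : chart_dom x y -> vrep X x (chart x y) = dtrans y x y (X y).
Proof. by move=> xy; rewrite /vrep (mfd_chartK hM xy). Qed.

Lemma vrep_self X x : vrep X x (chart x x) = X x.
Proof.
have xx := mfd_dom_self hM x.
by rewrite vrepE// dtrans_id.
Qed.

Lemma vrep_near X x (P : T -> T -> Prop) :
  (\forall y \near x, P (chart x y) (dtrans y x y (X y))) ->
  \forall w \near chart x x, P w (vrep X x w).
Proof.
move=> nP; have xx := mfd_dom_self hM x.
apply: filterS (nearI (near_chart_invK xx) (near_chart_inv xx (nearI nP (near_dom xx)))).
by move=> w [e [Pw d]]; rewrite -{2}e vrepE// -{1}e.
Qed.

Lemma vrep_change X x x' z : chart_dom x z -> chart_dom x' z ->
  \forall w \near chart x z, vrep X x w =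
    'D_(vrep X x' (chart x' (chart_inv x w))) (chart x \o chart_inv x')
      (chart x' (chart_inv x w)).
Proof.
move=> xz x'z.
apply: filterS (nearI (near_chart_invK xz)
  (near_chart_inv xz (nearI (near_dom xz) (near_dom x'z)))) => w [e [d d']].
rewrite vrepE// -[RHS]/(dtrans x' x (chart_inv x w) _).
by rewrite -{1}e vrepE// dtrans_comp//; exact: (mfd_dom_self hM).
Qed.

(** Smoothness at a point refers to the preferred chart of that point, so even its persistence at
    nearby points requires a change of chart. The new representative is the derivative of the
    transition map, with base point and direction both varying smoothly. *)
Lemma smooth_vf_change X x x' z : chart_dom x z -> chart_dom x' z ->
  smooth_near (chart x' z) (vrep X x') -> smooth_near (chart x z) (vrep X x).
Proof.
move=> xz x'z sX.
have e : (chart x' \o chart_inv x) (chart x z) = chart x' z :> T.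
  by rewrite /= (mfd_chartK hM xz).
have st := trans_smooth xz x'z.
have st' : smooth_near ((chart x' \o chart_inv x : T -> T) (chart x z)) (chart x \o chart_inv x' : T -> T).
  by rewrite e; exact: trans_smooth.
have sX' : smooth_near ((chart x' \o chart_inv x : T -> T) (chart x z)) (vrep X x').
  by rewrite e.
have fE := model_frame okE.
have H := smooth_near_dapp fE st (smooth_near_comp fE st sX') st'.
apply: smooth_near_ext H.
by apply: filterS (vrep_change X xz x'z) => w ->.
Qed.

Lemma smooth_vf_near X x : smooth_vf X x -> \forall y \near x, smooth_vf X y.
Proof.
move=> sX; have xx := mfd_dom_self hM x.
have n := near_chart xx (smooth_near_near sX).
apply: filterS (nearI n (near_dom xx)) => y [s d].
by apply: smooth_vf_change s => //; exact: (mfd_dom_self hM).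
Qed.

Lemma smooth_fun_ext (F : normedModType R) (f g : M -> F) x :
  (\forall y \near x, f y = g y) -> smooth_fun f x -> smooth_fun g x.
Proof.
move=> fg; apply: smooth_near_ext.
exact: (near_chart_inv (mfd_dom_self hM x) fg).
Qed.

Lemma smooth_fun_cst (F : normedModType R) (a : F) x : smooth_fun (fun=> a : F) x.
Proof. exact: smooth_near_cst. Qed.

Lemma smooth_vf_ext X Y x : (\forall y \near x, X y = Y y) ->
  smooth_vf X x -> smooth_vf Y x.
Proof.
move=> XY; apply: smooth_near_ext.
apply: filterS (near_chart_inv (mfd_dom_self hM x) XY) => w e.
by rewrite /vrep e.
Qed.

Lemma smooth_vfP (f : M -> R^o) X Y x : smooth_fun f x ->
  smooth_vf X x -> smooth_vf Y x ->
  smooth_vf (fun y => (f y : R) *: X y + Y y) x.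
Proof.
move=> sf sX sY; have xx := mfd_dom_self hM x.
apply: smooth_near_ext (smooth_nearD (smooth_near_scale sf sX) sY).
apply: filterS (near_chart_inv xx (near_dom xx)) => w d.
by rewrite /vrep !tcoordE dtransP//; exact: (mfd_dom_self hM).
Qed.

Lemma smooth_vf0 x : smooth_vf (fun=> 0 : T) x.
Proof.
have xx := mfd_dom_self hM x.
apply: smooth_near_ext (smooth_near_cst _ 0).
apply: filterS (near_chart_inv xx (near_dom xx)) => w d.
by rewrite /vrep /tcoord derive0.
Qed.

Lemma smooth_vfD X Y x : smooth_vf X x -> smooth_vf Y x ->
  smooth_vf (fun y => X y + Y y) x.
Proof.
move=> sX sY; apply: smooth_vf_ext (smooth_vfP (smooth_fun_cst (1 : R^o) x) sX sY).
by apply: filterE => y; rewrite scale1r.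
Qed.

Lemma smooth_vfZ (f : M -> R^o) X x : smooth_fun f x -> smooth_vf X x ->
  smooth_vf (fun y => (f y : R) *: X y) x.
Proof.
move=> sf sX; apply: smooth_vf_ext (smooth_vfP sf sX (smooth_vf0 x)).
by apply: filterE => y; rewrite addr0.
Qed.

Lemma smooth_vfZc (a : R) X x : smooth_vf X x -> smooth_vf (fun y => a *: X y) x.
Proof. by move=> sX; exact: (smooth_vfZ (smooth_fun_cst (a : R^o) x) sX). Qed.

Lemma smooth_vfN X x : smooth_vf X x -> smooth_vf (fun y => - X y) x.
Proof.
move=> sX; apply: smooth_vf_ext (smooth_vfZc (-1) sX).
by apply: filterE => y; rewrite scaleN1r.
Qed.

Lemma smooth_vfB X Y x : smooth_vf X x -> smooth_vf Y x ->
  smooth_vf (fun y => X y - Y y) x.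
Proof. by move=> sX sY; exact: smooth_vfD sX (smooth_vfN sY). Qed.

Lemma smooth_vfJ X x : smooth_vf X x -> smooth_vf (fun y => cJ (X y)) x.
Proof.
move=> sX; have xx := mfd_dom_self hM x.
apply: smooth_near_ext (smooth_near_cJ okE sX).
apply: filterS (near_chart_inv xx (near_dom xx)) => w d.
by rewrite /vrep !tcoordE dtransJ//; exact: (mfd_dom_self hM).
Qed.

Lemma ext_self x (u : T) : ext x u x = u.
Proof. by rewrite extE dtrans_id//; exact: (mfd_dom_self hM). Qed.

Lemma smooth_vf_local (W : T -> T) X x : smooth_near (chart x x) W ->
  (\forall y \near x, X y = dtrans x y y (W (chart x y))) -> smooth_vf X x.
Proof.
move=> sW eX; have xx := mfd_dom_self hM x.
apply: smooth_near_ext sW.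
apply: filterS (vrep_near (P := fun w v => v = W w) _) => [w <-//|].
apply: filterS (nearI eX (near_dom xx)) => y [-> d].
have yy := mfd_dom_self hM y.
by rewrite dtrans_comp// dtrans_id.
Qed.

Lemma smooth_vf_const x (u : T) : smooth_vf (ext x u) x.
Proof.
apply: (@smooth_vf_local (fun=> u)); first exact: smooth_near_cst.
by apply: filterE => y; rewrite extE.
Qed.

Lemma ext_nearJ x (u : T) : \forall y \near x, ext x (cJ u) y = cJ (ext x u y).
Proof.
have xx := mfd_dom_self hM x.
apply: filterS (near_dom xx) => y d; rewrite !extE dtransJ//.
exact: (mfd_dom_self hM).
Qed.

Lemma ext_nearP x (a : R) (u v : T) :
  \forall y \near x, ext x (a *: u + v) y = a *: ext x u y + ext x v y.
Proof.
have xx := mfd_dom_self hM x.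
apply: filterS (near_dom xx) => y d; rewrite !extE dtransP//.
exact: (mfd_dom_self hM).
Qed.

(** The coefficients are the coordinates of the chart representative, hence smooth if [Y] is; this
    feeds [tensorial]. *)
Lemma frame_decomp (I : finType) (e : I -> T) (c : I -> {linear T -> R^o}) Y x :
  (forall v, v = \sum_i (c i v : R) *: e i) ->
  \forall y \near x,
    Y y = \sum_i (c i (vrep Y x (chart x y)) : R) *: ext x (e i) y.
Proof.
move=> ce; have xx := mfd_dom_self hM x.
apply: filterS (near_dom xx) => y d; have yy := mfd_dom_self hM y.
rewrite vrepE//.
set v := dtrans y x y (Y y).
have -> : \sum_i (c i v : R) *: ext x (e i) y = dtrans x y y v.
  rewrite [in RHS](ce v) /dtrans [RHS]deriveE; last exact: trans_diff.
  rewrite linear_sum; apply: eq_bigr => i _.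
  by rewrite linearZ -deriveE//; exact: trans_diff.
by rewrite dtrans_comp// dtrans_id.
Qed.
End Manifold.

Section Functionals.
Variables (R : realType) (F : normedModType R) (hF : fin_frame F).

Lemma frame_separates (u v : F) :
  (forall L : F -> R, (forall (a : R) x y, L (a *: x + y) = a * L x + L y) -> L u = L v) ->
  u = v.
Proof.
move=> H; have [I [e [c [cc ce]]]] := hF.
apply: (etrans (ce u)); apply: (etrans _ (esym (ce v))).
apply: eq_bigr => i _; suff -> : c i u = c i v by [].
by apply: (H (c i)) => a x y; rewrite linearP.
Qed.
End Functionals.

Section LinearFunctional.
Variables (R : pzRingType) (V W : lmodType R) (L : V -> W).
Hypothesis hL : forall (a : R) x y, L (a *: x + y) = a *: L x + L y.

Lemma lfunD x y : L (x + y) = L x + L y.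
Proof. by rewrite -{1}(scale1r x) hL scale1r. Qed.
Lemma lfun0 : L 0 = 0.
Proof. by have := lfunD 0 0; rewrite addr0 -{1}(addr0 (L 0)) => /addrI. Qed.
Lemma lfunZ a x : L (a *: x) = a *: L x.
Proof. by rewrite -(addr0 (a *: x)) hL lfun0 addr0. Qed.
Lemma lfunN x : L (- x) = - L x.
Proof. by rewrite -scaleN1r lfunZ scaleN1r. Qed.
Lemma lfunB x y : L (x - y) = L x - L y.
Proof. by rewrite lfunD lfunN. Qed.
End LinearFunctional.

(** * Connections *)

Section Connection.
Variables (R : realType) (E : cmodel R) (okE : cmodel_ok E).
Variables (M : charted E) (hM : is_complex_manifold M).
Let T : normedModType R := cE E.
Implicit Types (x y z : M) (X Y Z : vfield M).

(** An operator that is local and linear over functions sees only the value at [x]: expand [Y] near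
    [x] in the fields [ext x (e i)] and pull out the coefficients. *)
Lemma tensorial (V : lmodType R) (S : vfield M -> V) x :
  (forall Y Z, smooth_vf Y x -> (\forall y \near x, Y y = Z y) -> S Y = S Z) ->
  (forall Y Z, smooth_vf Y x -> smooth_vf Z x -> S (fun y => Y y + Z y) = S Y + S Z) ->
  (forall (f : M -> R^o) Y, smooth_fun f x -> smooth_vf Y x ->
     S (fun y => (f y : R) *: Y y) = (f x : R) *: S Y) ->
  forall Y, smooth_vf Y x -> S Y = S (ext x (Y x)).
Proof.
move=> Sloc Sadd Slei.
have [I [e [c [cc ce]]]] := model_frame okE.
suff H Y : smooth_vf Y x -> S Y = \sum_i (c i (Y x) : R) *: S (ext x (e i)).
  move=> Y sY; rewrite H// H; last exact: smooth_vf_const.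
  by rewrite (ext_self hM).
move=> sY.
have sc i : smooth_fun (fun y => c i (vrep Y x (chart x y)) : R^o) x.
  have xx := mfd_dom_self hM x.
  apply: smooth_near_ext (smooth_near_linear (cc i) sY).
  by apply: filterS (near_chart_invK hM xx) => w ->.
have S0 : S (fun=> 0) = 0.
  have s0 := smooth_vf0 hM x.
  have := Slei (fun=> 0) (fun=> 0) (smooth_fun_cst (0 : R^o) x) s0.
  move=> eS; apply: (etrans _ (etrans eS (scale0r _))).
  by congr S; apply/funext => y; rewrite scaler0.
have se i : smooth_vf (fun y => (c i (vrep Y x (chart x y)) : R) *: ext x (e i) y) x.
  by apply: smooth_vfZ => //; exact: smooth_vf_const.
have Ssum (s : seq I) : S (fun y => \sum_(i <- s) (c i (vrep Y x (chart x y)) : R) *: ext x (e i) y) =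
    \sum_(i <- s) (c i (Y x) : R) *: S (ext x (e i)) /\
    smooth_vf (fun y => \sum_(i <- s) (c i (vrep Y x (chart x y)) : R) *: ext x (e i) y) x.
  elim: s => [|i s [IH1 IH2]].
    have -> : (fun y => \sum_(i <- [::]) (c i (vrep Y x (chart x y)) : R) *: ext x (e i) y) = (fun=> 0).
      by apply/funext => y; rewrite big_nil.
    by rewrite big_nil; split=> //; exact: smooth_vf0.
  have -> : (fun y => \sum_(j <- i :: s) (c j (vrep Y x (chart x y)) : R) *: ext x (e j) y) =
     (fun y => (c i (vrep Y x (chart x y)) : R) *: ext x (e i) y +
        \sum_(j <- s) (c j (vrep Y x (chart x y)) : R) *: ext x (e j) y).
    by apply/funext => y; rewrite big_cons.
  split; last exact: (smooth_vfD hM (se i) IH2).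
  rewrite (Sadd _ _ (se i) IH2) IH1 big_cons; congr (_ + _).
  rewrite (Slei _ _ (sc i) (smooth_vf_const hM x (e i))) (vrep_self hM).
  by [].
rewrite -[RHS](Ssum _).1; apply: Sloc => //.
exact: frame_decomp.
Qed.

Variables (D : covop M) (hD : is_connection D).

Lemma conn_germ Y Z x u : smooth_vf Y x -> (\forall y \near x, Y y = Z y) ->
  D Y x u = D Z x u.
Proof.
move=> sY YZ; have sZ := smooth_vf_ext hM YZ sY.
(* [f Y = f Z] everywhere, and [f] is 1 near [x]. *)
pose f y : R^o := if `[< Y y = Z y >] then 1 else 0.
have nf : \forall y \near x, 1 = f y.
  by apply: filterS YZ => y e; rewrite /f asboolT.
have sf : smooth_fun f x.
  exact: (smooth_fun_ext hM nf (smooth_fun_cst (1 : R^o) x)).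
have df : dfun f x u = 0.
  rewrite /dfun -[RHS](derive_cst (1 : R^o) (chart x x) u).
  apply: near_eq_derive.
  by apply: filterS (near_chart_inv hM (mfd_dom_self hM x) nf) => w <-.
have fx : f x = 1 by rewrite -(nbhs_singleton nf).
have e1 := conn_leibniz hD sf sY u; have e2 := conn_leibniz hD sf sZ u.
rewrite df fx scale0r addr0 scale1r in e1.
rewrite df fx scale0r addr0 scale1r in e2.
rewrite -e1 -e2; congr (D _ x u); apply/funext => y; rewrite /f.
by case: asboolP => [->|_]//; rewrite !scale0r.
Qed.

Lemma connZ (a : R) Y x u : smooth_vf Y x ->
  D (fun y => a *: Y y) x u = a *: D Y x u.
Proof.
move=> sY; have := conn_leibniz hD (smooth_fun_cst (a : R^o) x) sY u.
by rewrite /dfun derive_cst scale0r addr0.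
Qed.

Lemma connD Y Z x u : smooth_vf Y x -> smooth_vf Z x ->
  D (fun y => Y y + Z y) x u = D Y x u + D Z x u.
Proof. by move=> sY sZ; exact: (conn_add hD). Qed.

Lemma connN Y x u : smooth_vf Y x -> D (fun y => - Y y) x u = - D Y x u.
Proof.
move=> sY; rewrite -scaleN1r -connZ//; congr (D _ x u).
by apply/funext => y; rewrite scaleN1r.
Qed.

Lemma connB Y Z x u : smooth_vf Y x -> smooth_vf Z x ->
  D (fun y => Y y - Z y) x u = D Y x u - D Z x u.
Proof.
by move=> sY sZ; rewrite -connN// -connD//; exact: smooth_vfN.
Qed.

Lemma covJ_linear_l x (a : R) u u' v :
  covJ D x (a *: u + u') v = a *: covJ D x u v + covJ D x u' v.
Proof.
have s1 := smooth_vf_const hM x v; have s2 := smooth_vfJ okE hM s1.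
rewrite /covJ !(conn_linear hD)// (cJP okE) scalerBr opprD.
by rewrite addrACA.
Qed.

(** [covJ] is defined through the extension [ext]; any smooth extension may be used, because the
    derivative terms in the Leibniz rules for [Y] and [cJ Y] cancel. *)
Lemma covJ_tensor Y x u : smooth_vf Y x ->
  covJ D x u (Y x) = D (fun y => cJ (Y y)) x u - cJ (D Y x u).
Proof.
pose S Y : T := D (fun y => cJ (Y y)) x u - cJ (D Y x u).
move=> sY; rewrite -[RHS]/(S Y) (@tensorial _ S x)//.
- move=> Y1 Y2 s1 e; have s2 := smooth_vf_ext hM e s1.
  rewrite /S (conn_germ _ s1 e); congr (_ - _).
  apply: conn_germ; first exact: smooth_vfJ.
  by apply: filterS e => y ->.
- move=> Y1 Y2 s1 s2.
  have s1' := smooth_vfJ okE hM s1; have s2' := smooth_vfJ okE hM s2.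
  have -> : S (fun y => Y1 y + Y2 y) = (D (fun y => cJ (Y1 y)) x u + D (fun y => cJ (Y2 y)) x u) -
      cJ (D Y1 x u + D Y2 x u).
    rewrite /S (connD _ s1 s2) -(connD _ s1' s2'); congr (D _ x u - _).
    by apply/funext => y; rewrite (cJD okE).
  by rewrite (cJD okE) opprD addrACA.
- move=> f Y1 sf s1; have s2 := smooth_vfJ okE hM s1.
  rewrite /S (conn_leibniz hD sf s1) (cJD okE) !(cJZ okE).
  have -> : (fun y => cJ ((f y : R) *: Y1 y)) = (fun y => (f y : R) *: cJ (Y1 y)).
    by apply/funext => y; rewrite (cJZ okE).
  rewrite (conn_leibniz hD sf s2) scalerBr opprD addrACA.
  by rewrite subrr addr0.
Qed.
End Connection.

(** * Vector identities reduced to scalar ones *)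

Section JIdentities.
Variables (R : realType) (E : cmodel R) (okE : cmodel_ok E).
Let T : normedModType R := cE E.

(** Makes [ring], [field] and [lra] available for vector equations: an arbitrary linear functional
    turns them into equations between real numbers. *)
Lemma Jseparates (u v : T) :
  (forall L : T -> R, (forall x y, L (x + y) = L x + L y) ->
     (forall x, L (- x) = - L x) ->
     (forall (a : R) x, L (a *: x) = a * L x) -> L u = L v) -> u = v.
Proof.
move=> H; apply: (frame_separates (model_frame okE)) => L hL.
pose L' : T -> R^o := L.
apply: H; [exact: (@lfunD _ _ _ L' hL)|exact: (@lfunN _ _ _ L' hL)|exact: (@lfunZ _ _ _ L' hL)].
Qed.

(** The algebra of [covprime_curv]. [a1], [a2] are iterated derivatives of Z, [b1], [b2] those of
    JZ, [z], [z'] the bracket terms, [p], [q] are A applied to a derivative of Z, and [r], [s] are A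
    A Z; flatness gives the two hypotheses. Each iterated nabla' derivative simplifies to (a - J b)
    / 2 - r / 4, so [p] and [q] cancel. *)
Lemma prime_curv_identity (a1 a2 b1 b2 z z' p q r s : T) :
  a1 - a2 = z -> b1 - b2 = z' ->
  2^-1 *: (2^-1 *: (a1 - (cJ b1 + (r - cJ p))) - cJ (2^-1 *: (cJ a1 + p + b1)))
  - 2^-1 *: (2^-1 *: (a2 - (cJ b2 + (s - cJ q))) - cJ (2^-1 *: (cJ a2 + q + b2)))
  - 2^-1 *: (z - cJ z') = - 4^-1 *: (r - s).
Proof.
move=> <- <-; rewrite !(cJD okE, cJN okE, cJZ okE, model_JJ okE).
apply: Jseparates => L LD LN LZ; rewrite !(LD, LN, LZ).
move: (L a1) (L a2) (L (cJ b1)) (L (cJ b2)) (L (cJ p)) (L (cJ q)) (L r) (L s) => *; lra.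
Qed.
(** The algebra of [induced_curvature]: [a], [b], [c] are the projected terms of the curvature of
    nabla'. Primed scalars enter negated because the J xi coefficient of a vertical part is - Q(X,
    JY). *)
Lemma induced_curvature_identity (a b c d u v w u' v' w' : T) (q1 q1' q2 q2' q3 q3' q4 q4' : R) :
  a - b - c = d ->
  a - (q1 *: u + (- q1') *: u') - (b - (q2 *: v + (- q2') *: v'))
    - (c - ((q3 - q4) *: w + (- q3' - - q4') *: w')) =
  d - (q1 *: u - q1' *: u') + (q2 *: v - q2' *: v')
    + ((q3 - q4) *: w - (q3' - q4') *: w').
Proof.
move=> <-; apply: Jseparates => L LD LN LZ; rewrite !(LD, LN, LZ).
move: (L a) (L b) (L c) (L u) (L v) (L w) (L u') (L v') (L w') => *; ring.
Qed.
End JIdentities.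

(** * Special complex manifolds *)

Section Special.
Variables (R : realType) (E : cmodel R) (okE : cmodel_ok E).
Variables (M : charted E) (hM : is_complex_manifold M).
Variables (D : covop M) (hS : special_complex D).
Let T : normedModType R := cE E.
Implicit Types (x y z : M) (X Y Z : vfield M).

Let hD : is_connection D. Proof. by case: hS. Qed.
Let tf : torsion_free D. Proof. by case: hS. Qed.

Lemma covJC x u v : covJ D x u v = covJ D x v u.
Proof. by case: hS. Qed.

Lemma covJ_linear_r x (a : R) u v v' :
  covJ D x u (a *: v + v') = a *: covJ D x u v + covJ D x u v'.
Proof. by rewrite covJC (covJ_linear_l okE hM hD) covJC (covJC _ v'). Qed.

Lemma covJ_Jr x u v : covJ D x u (cJ v) = - cJ (covJ D x u v).
Proof.
have s := smooth_vf_const hM x v; have sJ := smooth_vfJ okE hM s.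
have := covJ_tensor okE hM hD u sJ; rewrite (ext_self hM) => ->.
have -> : (fun y => cJ (cJ (ext x v y))) = (fun y => - ext x v y).
  by apply/funext => y; rewrite (model_JJ okE).
by rewrite (connN hD)// /covJ (cJB okE) (model_JJ okE) opprB.
Qed.

Lemma covprimeE Y x u : smooth_vf Y x ->
  covprime D Y x u = 2^-1 *: (D Y x u - cJ (D (fun y => cJ (Y y)) x u)).
Proof.
move=> sY; rewrite /covprime (covJ_tensor okE hM hD u sY).
rewrite (cJB okE) (model_JJ okE) opprK.
apply: (Jseparates okE) => L LD LN LZ; rewrite !(LD, LN, LZ).
move: (L (D Y x u)) (L (cJ _)) => *; lra.
Qed.

Lemma covprime_smooth X Y x : smooth_vf X x -> smooth_vf Y x ->
  smooth_vf (fun y => covprime D Y y (X y)) x.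
Proof.
move=> sX sY; have sJ := smooth_vfJ okE hM sY.
have s : smooth_vf (fun y => 2^-1 *: (D Y y (X y) - cJ (D (fun y => cJ (Y y)) y (X y)))) x.
  apply: (smooth_vfZc hM); apply: (smooth_vfB hM (conn_smooth hD sX sY)).
  exact: (smooth_vfJ okE hM (conn_smooth hD sX sJ)).
apply: smooth_vf_ext s => //.
by apply: filterS (smooth_vf_near okE hM sY) => y sy; rewrite covprimeE.
Qed.

Lemma covprime_connection : is_connection (covprime D).
Proof.
split.
- move=> Y x sY a u v; rewrite /covprime (conn_linear hD sY) (covJ_linear_l okE hM hD).
  rewrite (cJP okE) scalerDr opprD !scalerBr addrACA; congr (_ - _ + _).
  by rewrite !scalerA mulrC.
- move=> Y Z x sY sZ u; rewrite /covprime (connD hD)//.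
  have := covJ_linear_r x 1 u (Y x) (Z x); rewrite !scale1r => ->.
  by rewrite (cJD okE) scalerDr opprD addrACA.
- move=> f Y x sf sY u; rewrite /covprime (conn_leibniz hD sf sY).
  have := covJ_linear_r x (f x) u (Y x) 0; rewrite !addr0 => ->.
  have -> : covJ D x u 0 = 0.
    have := covJ_linear_r x 1 u 0 0; rewrite !scale1r addr0 => /esym e.
    by apply: (addrI (covJ D x u 0)); rewrite addr0.
  rewrite addr0 (cJZ okE) scalerBr addrAC; congr (_ - _ + _).
  by rewrite !scalerA mulrC.
- by move=> X Y x sX sY; exact: covprime_smooth.
Qed.

Lemma covprime_torsion_free : torsion_free (covprime D).
Proof.
move=> X Y x sX sY; rewrite -tf// /covprime covJC.
by rewrite opprB addrA subrK.
Qed.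

Lemma covprime_J Y x u : smooth_vf Y x ->
  covprime D (fun y => cJ (Y y)) x u = cJ (covprime D Y x u).
Proof.
move=> sY; have sJ := smooth_vfJ okE hM sY.
rewrite !covprimeE// (cJZ okE); congr (_ *: _).
have -> : (fun y => cJ (cJ (Y y))) = (fun y => - Y y).
  by apply/funext => y; rewrite (model_JJ okE).
by rewrite (connN hD)// (cJN okE) (cJB okE) (model_JJ okE) opprK addrC opprK.
Qed.

(* [a], [b] below are the covariant derivatives of [Z] for [nabla] and of [JZ],
   hence up to [J] for the two flat connections [nabla], [- J nabla J]. *)
Lemma covprime_curv X Y Z x : smooth_vf X x -> smooth_vf Y x -> smooth_vf Z x ->
  curv (covprime D) X Y Z x =
  - 4^-1 *: (covJ D x (X x) (covJ D x (Y x) (Z x))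
           - covJ D x (Y x) (covJ D x (X x) (Z x))).
Proof.
move=> sX sY sZ; have sJ := smooth_vfJ okE hM sZ.
have fl : flat D by case: hS.
pose JZ : vfield M := fun y => cJ (Z y).
have key V U (sV : smooth_vf V x) (sU : smooth_vf U x) :
  covprime D (fun y => covprime D Z y (V y)) x (U x) =
  2^-1 *: (2^-1 *: (D (fun y => D Z y (V y)) x (U x) -
       (cJ (D (fun y => D JZ y (V y)) x (U x)) +
         (covJ D x (U x) (covJ D x (V x) (Z x)) - cJ (covJ D x (U x) (D Z x (V x)))))) -
    cJ (2^-1 *: (cJ (D (fun y => D Z y (V y)) x (U x)) + covJ D x (U x) (D Z x (V x))
        + D (fun y => D JZ y (V y)) x (U x)))).
  pose a : vfield M := fun y => D Z y (V y).
  pose b : vfield M := fun y => D JZ y (V y).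
  have sa : smooth_vf a x by exact: (conn_smooth hD).
  have sb : smooth_vf b x by exact: (conn_smooth hD).
  have sJa := smooth_vfJ okE hM sa; have sJb := smooth_vfJ okE hM sb.
  pose W : vfield M := fun y => 2^-1 *: (a y - cJ (b y)).
  have sW : smooth_vf W x by apply: smooth_vfZc => //; exact: smooth_vfB.
  have -> : covprime D (fun y => covprime D Z y (V y)) x (U x) = covprime D W x (U x).
    apply: (conn_germ hM covprime_connection); first exact: covprime_smooth.
    by apply: filterS (smooth_vf_near okE hM sZ) => y sy; rewrite covprimeE.
  rewrite covprimeE//; congr (_ *: (_ - cJ _)).
    rewrite (connZ hD); last exact: smooth_vfB.
    rewrite (connB hM hD)//; congr (_ *: (_ - _)).
    have := covJ_tensor okE hM hD (U x) sb; rewrite -/(cJ _).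
    (* As A anticommutes with J, A_U b = A_U A_V Z - J A_U a; this is the origin of the quadratic
       term of the curvature. *)
    have -> : b x = cJ (a x) + covJ D x (V x) (Z x).
      by rewrite (covJ_tensor okE hM hD (V x) sZ) addrC subrK.
    have := covJ_linear_r x 1 (U x) (cJ (a x)) (covJ D x (V x) (Z x)); rewrite !scale1r => ->.
    rewrite covJ_Jr => e; rewrite [covJ _ _ _ _ - _]addrC e addrC subrK.
    by [].
  have -> : (fun y => cJ (W y)) = (fun y => 2^-1 *: (cJ (a y) + b y)).
    by apply/funext => y; rewrite /W (cJZ okE) (cJB okE) (model_JJ okE) opprK.
  rewrite (connZ hD); last exact: smooth_vfD.
  rewrite (connD hD)//; congr (_ *: (_ + _)).
  by rewrite (covJ_tensor okE hM hD (U x) sa) addrC subrK.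
rewrite /curv (key Y X)// (key X Y)// covprimeE//.
apply: prime_curv_identity => //.
  by have /eqP := fl X Y Z x sX sY sZ; rewrite subr_eq0 => /eqP.
by have /eqP := fl X Y JZ x sX sY sJ; rewrite subr_eq0 => /eqP.
Qed.

Variables (xi : vfield M) (hC : conical_special_complex D xi).

(** Torsion-freeness and nabla xi = id give nabla_xi Y = Y + [xi, Y], an operator commuting with J
    since L_xi J = 0. Thus A_xi = 0, and symmetry of A moves [xi] to the other slot. *)
Lemma covJ_xi x u : covJ D x u (xi x) = 0.
Proof.
have [_ sxi dxi lxi] := hC.
have su := smooth_vf_const hM x u; have sJ := smooth_vfJ okE hM su.
rewrite covJC /covJ.
have e1 : D (ext x u) x (xi x) = u + lie xi (ext x u) x.
  by rewrite -tf// dxi (ext_self hM) addrC subrK.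
have e2 : D (fun y => cJ (ext x u y)) x (xi x) = cJ u + lie xi (fun y => cJ (ext x u y)) x.
  by rewrite -tf// dxi (ext_self hM) addrC subrK.
by rewrite e1 e2 (cJD okE) opprD addrACA subrr add0r lxi.
Qed.

Lemma covprime_xi x u : covprime D xi x u = u.
Proof.
have [_ sxi dxi lxi] := hC.
by rewrite /covprime covJ_xi dxi (cJ0 okE) scaler0 subr0.
Qed.

Lemma covprime_Jxi x u : covprime D (fun y => cJ (xi y)) x u = cJ u.
Proof.
have [_ sxi _ _] := hC.
by rewrite covprime_J// covprime_xi.
Qed.
End Special.

(** * Maps and related vector fields *)

Section DeriveApply.
Variables (R : realType) (E G : normedModType R).

Lemma derive_bigsum (I : finType) (f : I -> E -> G) (x v : E) :
  (forall i, differentiable (f i) x) ->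
  'D_v (fun y => \sum_i f i y) x = \sum_i 'D_v (f i) x.
Proof.
move=> df; suff H (s : seq I) : differentiable (fun y => \sum_(i <- s) f i y) x /\
    'D_v (fun y => \sum_(i <- s) f i y) x = \sum_(i <- s) 'D_v (f i) x.
  exact: (H _).2.
elim: s => [|i s [IH1 IH2]].
  have -> : (fun y => \sum_(i <- [::]) f i y) = cst 0.
    by apply/funext => y; rewrite big_nil.
  by rewrite big_nil derive_cst; split=> //; exact: differentiable_cst.
have -> : (fun y => \sum_(j <- i :: s) f j y) = f i + (fun y => \sum_(j <- s) f j y).
  by apply/funext => y; rewrite big_cons.
split; first exact: differentiableD.
by rewrite deriveD; [rewrite IH2 big_cons|exact: diff_derivable|exact: diff_derivable].
Qed.

(** The product rule for dP(X), obtained by expanding the direction in a frame so that only products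
    of functions are differentiated. *)
Lemma derive_dapp (X : E -> E) (P : E -> G) (x v : E) : fin_frame E ->
  smooth_near x X -> smooth_near x P ->
  'D_v (fun w => 'D_(X w) P w) x =
    'D_('D_v X x) P x + 'D_v (fun w => 'D_(X x) P w) x.
Proof.
move=> fE sX sP; have [I [e [c [cc ce]]]] := fE.
have exp (u w : E) : smooth_near w P ->
    'D_u P w = \sum_i (c i u : R) *: 'D_(e i) P w.
  move=> sw; have := @derive_frame R E E G I e c id P w u ce (smooth_near_diff sw).
  by [].
have sD i : smooth_near x (fun w => 'D_(e i) P w) by exact: smooth_near_derive.
have dD i := smooth_near_diff (sD i).
have dX := smooth_near_diff sX.
have dcX i : differentiable (c i \o X) x.
  by apply: differentiable_comp => //; exact: linear_differentiable.
have nP := smooth_near_near sP.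
have -> : 'D_v (fun w => 'D_(X w) P w) x =
    'D_v (fun w => \sum_i (c i (X w) : R) *: 'D_(e i) P w) x.
  by apply: near_eq_derive; apply: filterS nP => w sw; exact: exp.
have -> : 'D_v (fun w => 'D_(X x) P w) x =
    'D_v (fun w => \sum_i (c i (X x) : R) *: 'D_(e i) P w) x.
  by apply: near_eq_derive; apply: filterS nP => w sw; exact: exp.
rewrite (exp _ _ sP).
rewrite (@derive_bigsum I (fun i w => (c i (X w) : R) *: 'D_(e i) P w)); last first.
  by move=> i; have [] := diff_scale (dcX i) (dD i).
rewrite (@derive_bigsum I (fun i w => (c i (X x) : R) *: 'D_(e i) P w)); last first.
  move=> i.
  by have [] := diff_scale (@differentiable_cst _ _ _ (c i (X x)) x) (dD i).
rewrite -big_split; apply: eq_bigr => i _.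
have [_ ->] := diff_scale (dcX i) (dD i).
have [_ e2] := diff_scale (@differentiable_cst _ _ _ (c i (X x)) x) (dD i).
apply: (etrans (addrC _ _)); congr (_ + _); last first.
  by apply: esym; apply: (etrans (e2 v)); rewrite derive_cst scale0r addr0.
rewrite (derive_comp v dX (linear_differentiable _ (cc i))).
by rewrite derive_linear_map.
Qed.
Lemma derive_subl (P : E -> G) (x u v : E) : differentiable P x ->
  'D_(u - v) P x = 'D_u P x - 'D_v P x.
Proof. by move=> dP; rewrite !deriveE// linearB. Qed.
End DeriveApply.

Section MapTheory.
Variables (R : realType) (E F : cmodel R).
Variables (okE : cmodel_ok E) (okF : cmodel_ok F).
Variables (M : charted E) (N : charted F).
Variables (hM : is_complex_manifold M) (hN : is_complex_manifold N).
Variables (f : M -> N) (hf : smooth_map_on setT f).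

Let cf x : {for x, continuous f}. Proof. by have [] := hf (I : setT x). Qed.
Let sf x : smooth_near (chart x x) (chart_rep f x).
Proof. by have [] := hf (I : setT x). Qed.

Lemma near_preimage x (P : N -> Prop) : (\forall b \near f x, P b) -> \forall y \near x, P (f y).
Proof. by move=> nP; have c : f @ x --> f x := @cf x; exact: (c _ nP). Qed.

Lemma dmapP x (a : R) u v : dmap f x (a *: u + v) = a *: dmap f x u + dmap f x v.
Proof. by apply: derive_linear; apply: smooth_near_diff; exact: sf. Qed.

(** [dmap f y] refers to the charts at [y] and [f y]. To treat it as a function of [y] it is
    compared with the derivative of one fixed representative, in the charts at [x] and [f x]. *)
Lemma chart_rep_change x : \forall y \near x, forall v,
  'D_(dtrans y x y v) (chart_rep f x) (chart x y) =
  dtrans (f y) (f x) (f y) (dmap f y v).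
Proof.
have xx := mfd_dom_self hM x; have fxx := mfd_dom_self hN (f x).
have n1 := near_chart hM xx (smooth_near_near (@sf x)).
have n2 := near_preimage (near_dom hN fxx).
apply: filterS (nearI n1 (nearI n2 (near_dom hM xx))) => y [sy [dy d]] v.
have yy := mfd_dom_self hM y; have fyy := mfd_dom_self hN (f y).
have e1 : (chart x \o chart_inv y) (chart y y) = chart x y.
  by rewrite /= (mfd_chartK hM yy).
have e2 : chart_rep f y (chart y y) = chart (f y) (f y).
  by rewrite /chart_rep (mfd_chartK hM yy).
have d1 := trans_diff hM yy d.
have dr : differentiable (chart_rep f x) ((chart x \o chart_inv y) (chart y y)).
  by rewrite e1; exact: smooth_near_diff.
rewrite -e1 /dtrans -(derive_comp v d1 dr).
have dry : differentiable (chart_rep f y) (chart y y) by exact/smooth_near_diff/sf.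
have d2 : differentiable (chart (f x) \o chart_inv (f y) : cE F -> cE F) (chart_rep f y (chart y y)).
  by rewrite e2; exact: trans_diff.
rewrite -{1}e2 /dmap -(derive_comp v dry d2); apply: near_eq_derive.
have n3 := near_chart_inv hM yy (nearI (near_dom hM d) (near_preimage (nearI (near_dom hN fyy) (near_dom hN dy)))).
apply: filterS n3 => w [dw [dw' dw'']] /=.
by rewrite /chart_rep /= (mfd_chartK hM dw) (mfd_chartK hN dw').
Qed.

Definition related_at (X : vfield M) (X' : vfield N) (x : M) : Prop :=
  \forall y \near x, dmap f y (X y) = X' (f y).

Lemma related_vrep (X : vfield M) (X' : vfield N) x : related_at X X' x ->
  \forall w \near chart x x,
    'D_(vrep X x w) (chart_rep f x) w = vrep X' (f x) (chart_rep f x w).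
Proof.
move=> rX; have xx := mfd_dom_self hM x; have fxx := mfd_dom_self hN (f x).
have n := near_chart_inv hM xx (nearI (near_dom hM xx) (nearI (chart_rep_change x)
  (nearI rX (near_preimage (near_dom hN fxx))))).
apply: filterS (nearI n (near_chart_invK hM xx)) => w [[d [e [r d']]] ew].
have := e (X (chart_inv x w)); rewrite -(vrepE hM) ?ew// => ->.
by rewrite r -(vrepE hN).
Qed.

(** In charts, relatedness says that dP(X) is X' composed with P. Differentiate this along Y, do the
    same with X and Y exchanged, and subtract. *)
Lemma lie_related (X Y : vfield M) (X' Y' : vfield N) x :
  smooth_vf X x -> smooth_vf Y x -> smooth_vf X' (f x) -> smooth_vf Y' (f x) ->
  related_at X X' x -> related_at Y Y' x ->
  dmap f x (lie X Y x) = lie X' Y' (f x).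
Proof.
move=> sX sY sX' sY' rX rY.
have fE := model_frame okE; have fF := model_frame okF.
have xx := mfd_dom_self hM x.
pose P := chart_rep f x; pose w0 := chart x x.
have sP : smooth_near w0 P by exact: sf.
have Pw0 : P w0 = chart (f x) (f x) by rewrite /P /chart_rep (mfd_chartK hM xx).
have dP := smooth_near_diff sP.
have main (U V : vfield M) (U' : vfield N) : smooth_vf U x -> smooth_vf U' (f x) ->
    related_at U U' x ->
    'D_('D_(V x) (vrep U x) w0) P w0 =
    'D_(dmap f x (V x)) (vrep U' (f x)) (chart (f x) (f x)) -
    'D_(V x) (fun w => 'D_(U x) P w) w0.
  move=> sU sU' rU.
  have := derive_dapp (V x) fE sU sP.
  rewrite (vrep_self hM) => e.
  have dU' : differentiable (vrep U' (f x)) (P w0).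
    by rewrite Pw0; exact: smooth_near_diff.
  have e2 : 'D_(V x) (fun w => 'D_(vrep U x w) P w) w0 = 'D_(V x) (vrep U' (f x) \o P) w0.
    by apply: near_eq_derive; exact: related_vrep.
  rewrite (derive_comp _ dP dU') Pw0 in e2.
  by rewrite -[dmap f x _]/('D_(V x) P w0) -e2 e addrK.
rewrite /lie /dmap -/P -/w0.
have -> : 'D_('D_(X x) (vrep Y x) w0 - 'D_(Y x) (vrep X x) w0) P w0 =
    'D_('D_(X x) (vrep Y x) w0) P w0 - 'D_('D_(Y x) (vrep X x) w0) P w0.
  exact: derive_subl.
rewrite (main Y X Y')// (main X Y X')//.
(* The remaining second derivatives of [P] cancel by symmetry. *)
rewrite (schwarz (X x) (Y x) fF sP).
rewrite opprB addrA subrK.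
by rewrite (nbhs_singleton rX) (nbhs_singleton rY).
Qed.

Lemma smooth_fun_pull (G : normedModType R) (g : N -> G) x :
  smooth_fun g (f x) -> smooth_fun (fun y => g (f y)) x.
Proof.
move=> sg; have xx := mfd_dom_self hM x; have fxx := mfd_dom_self hN (f x).
have sg' : smooth_near (chart_rep f x (chart x x)) (fun w => g (chart_inv (f x) w)).
  by rewrite /chart_rep (mfd_chartK hM xx).
have H := smooth_near_comp (model_frame okF) (@sf x) sg'.
apply: smooth_near_ext H.
apply: filterS (near_chart_inv hM xx (near_preimage (near_dom hN fxx))) => w d /=.
by rewrite /chart_rep (mfd_chartK hN d).
Qed.
End MapTheory.

(** * Holomorphic principal bundles *)

Section Bundle.
Variables (R : realType) (E F : cmodel R).
Variables (okE : cmodel_ok E) (okF : cmodel_ok F).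
Variables (N : charted E) (Nb : charted F).
Variables (hN : is_complex_manifold N) (hNb : is_complex_manifold Nb).
Variables (act : cE (C1 R) -> N -> N) (p : N -> Nb).
Variables (hB : holo_principal_bundle act p).
Let CC : normedModType R := cE (C1 R).

Let hp : smooth_map_on setT p. Proof. by case: (proj_holo hB). Qed.
Lemma cmul_div (c d : CC) : d != 0 -> exists a : CC, cmul a d = c.
Proof.
case: c d => [c1 c2] [d1 d2] d0.
have n0 : (d1 : R) ^+ 2 + (d2 : R) ^+ 2 != 0.
  apply/eqP => e; move/eqP: d0; apply.
  have := e => /eqP; rewrite paddr_eq0 ?sqr_ge0// !sqrf_eq0 => /andP[/eqP-> /eqP->].
  by [].
(* The quotient c / d, written as c times the conjugate of d over the squared modulus of d. *)
exists (((c1 : R) * d1 + (c2 : R) * d2) / ((d1 : R) ^+ 2 + (d2 : R) ^+ 2),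
        ((c2 : R) * d1 - (c1 : R) * d2) / ((d1 : R) ^+ 2 + (d2 : R) ^+ 2)).
rewrite /cmul /=; move: (c1 : R) (c2 : R) (d1 : R) (d2 : R) n0 => x1 x2 y1 y2 n0.
by congr (_, _); field.
Qed.

Lemma cmulP (a : R) (u v d : CC) : cmul (a *: u + v) d = a *: cmul u d + cmul v d.
Proof.
case: u v d => [u1 u2] [v1 v2] [d1 d2].
rewrite -[LHS]/((a * u1 + v1) * d1 - (a * u2 + v2) * d2 : R,
  (a * u1 + v1) * d2 + (a * u2 + v2) * d1 : R).
rewrite -[RHS]/(a * (u1 * d1 - u2 * d2) + (v1 * d1 - v2 * d2) : R,
  a * (u1 * d2 + u2 * d1) + (v1 * d2 + v2 * d1) : R).
move: (u1 : R) (u2 : R) (v1 : R) (v2 : R) (d1 : R) (d2 : R) => {}u1 {}u2 {}v1 {}v2 {}d1 {}d2.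
by congr (_, _); ring.
Qed.

Lemma cmul1 (d : CC) : cmul (cone R) d = d.
Proof. by case: d => d1 d2; rewrite /cmul /cone /= !mul1r !mul0r subr0 addr0. Qed.

Section Trivialization.
Variables (t : local_triv act p) (z : N) (tz : triv_dom t (p z)).
Let phi : N -> CC := triv_phi t.
Let b0 : cE F := chart (p z) (p z).
Let c0 : CC := phi z.
Let q0 : (cE F * CC)%type := (b0, c0).
Let P : cE E -> cE F := chart_rep p z.
Let Phi : cE E -> CC := fun w => phi (chart_inv z w).
Let w0 := chart z z.
Let zz := mfd_dom_self hN z.
Let pzz := mfd_dom_self hNb (p z).

(* In charts, [triv_rep] is the inverse of [(P, Phi)]. *)
Definition triv_rep : (cE F * CC)%type -> cE E :=
  fun q => chart z (triv_inv t (chart_inv (p z) q.1, q.2)).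
Local Notation G := triv_rep.

Lemma c0_neq0 : c0 != 0. Proof. exact: triv_phi_neq0. Qed.

Lemma triv_rep_smooth : smooth_near q0 G.
Proof.
have [_ s] := @triv_inv_smooth _ _ _ _ _ _ _ t (p z, phi z) (conj tz c0_neq0).
by move: s; rewrite /chart_rep (triv_phiK tz).
Qed.

Lemma P_smooth : smooth_near w0 P.
Proof. by have [] := hp (I : setT z). Qed.

Lemma Phi_smooth : smooth_near w0 Phi.
Proof. by have [_] := @triv_phi_smooth _ _ _ _ _ _ _ t z tz. Qed.

Lemma P_w0 : P w0 = b0. Proof. by rewrite /P /chart_rep (mfd_chartK hN zz). Qed.
Lemma Phi_w0 : Phi w0 = c0. Proof. by rewrite /Phi (mfd_chartK hN zz). Qed.

Lemma near_triv_inv (A : N -> Prop) : (\forall y \near z, A y) ->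
  \forall q \near q0, A (triv_inv t (chart_inv (p z) q.1, q.2)).
Proof.
move=> nA.
have [c _] := @triv_inv_smooth _ _ _ _ _ _ _ t (p z, phi z) (conj tz c0_neq0).
have c' : triv_inv t @ ((p z, phi z) : prod_charted Nb (C_charted R)) --> triv_inv t (p z, phi z) by exact: c.
rewrite (triv_phiK tz) in c'.
have n1 := c' _ nA.
have ci : (chart_inv (p z) : cE F -> Nb) @ b0 --> p z.
  have h : (chart_inv (p z) : cE F -> Nb) @ chart (p z) (p z) --> chart_inv (p z) (chart (p z) (p z)) by exact: (mfd_inv_cont hNb pzz).
  by rewrite (mfd_chartK hNb pzz) in h.
have cq : (fun q : cE F * CC => (chart_inv (p z) q.1, q.2) : prod_charted Nb (C_charted R)) @ q0 --> ((p z, phi z) : prod_charted Nb (C_charted R)).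
  have c1 : (fun q : cE F * CC => chart_inv (p z) q.1 : Nb) @ q0 --> p z.
    have h1 : (fst : cE F * CC -> cE F) @ q0 --> b0 by exact: cvg_fst.
    exact: (cvg_comp _ _ h1 ci).
  have c2 : (fun q : cE F * CC => q.2) @ q0 --> c0 by exact: cvg_snd.
  exact: (cvg_pair c1 c2).
exact: (cq _ n1).
Qed.

Lemma near_q0 (A : cE F -> Prop) (A' : CC -> Prop) :
  (\forall b \near b0, A b) -> (\forall c \near c0, A' c) ->
  \forall q \near q0, A q.1 /\ A' q.2.
Proof.
move=> nA nA'; have h1 : fst @ q0 --> b0 by exact: cvg_fst.
have h2 : snd @ q0 --> c0 by exact: cvg_snd.
exact: (nearI (h1 _ nA) (h2 _ nA')).
Qed.

Lemma near_triv_dom : \forall b \near p z, triv_dom t b.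
Proof. exact: (open_nbhs_nbhs (conj (triv_open t) tz)). Qed.

Lemma P_triv_rep : \forall q \near q0, P (G q) = q.1.
Proof.
have nc : \forall c \near c0, c != 0 :> CC.
  have h : (fun c : CC => c) @ c0 --> c0 by exact: cvg_id.
  exact: (cvgr_neq0 _ h c0_neq0).
have nb := nearI (near_chart_invK hNb pzz) (near_chart_inv hNb pzz near_triv_dom).
apply: filterS (nearI (near_q0 nb nc) (near_triv_inv (near_dom hN zz))) => q [[[e d] cn] d'].
by rewrite /P /chart_rep /G (mfd_chartK hN d') (triv_p_inv d cn).
Qed.

Lemma triv_rep_P : \forall w \near w0, G (P w, Phi w) = w.
Proof.
have n := near_chart_inv hN zz (nearI (near_dom hN zz) (near_preimage hp (nearI (near_dom hNb pzz) near_triv_dom))).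
apply: filterS (nearI n (near_chart_invK hN zz)) => w [[d [d' tw]] e].
by rewrite /G /P /Phi /chart_rep /= (mfd_chartK hNb d') (triv_phiK tw).
Qed.

(** Equivariance makes the orbit map c |-> c z equal to c |-> (p z, c c0) in the trivialization, and
    the latter is affine. *)
Lemma fundamentalE (a : CC) : fundamental act a z = 'D_(0, cmul a c0) G q0.
Proof.
pose A (c : CC) : (cE F * CC)%type := (b0, cmul c c0).
have lA : linear (fun c : CC => cmul c c0) by move=> x u v; exact: cmulP.
pose LA : {linear CC -> CC} := HB.pack (fun c : CC => cmul c c0)
   (GRing.isLinear.Build _ _ _ _ _ lA).
have fC : fin_frame CC by apply: fin_frame_prod; exact: fin_frame_R.
have cLA : continuous LA := linear_frame_continuous fC.
have dLA : differentiable LA (cone R : CC) by exact: linear_differentiable.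
have dA : differentiable A (cone R : CC).
  by apply: differentiable_pair => //; exact: differentiable_cst.
have eA : 'D_a A (cone R : CC) = (0, cmul a c0).
  rewrite (derive_pair _ (differentiable_cst _ _) dLA) derive_cst.
  by rewrite (derive_linear_map (cone R : CC) a cLA).
have A1 : A (cone R) = q0 by rewrite /A cmul1.
have dG : differentiable G (A (cone R)).
  by rewrite A1; apply: smooth_near_diff; exact: triv_rep_smooth.
rewrite -{1}eA -{1}A1 -(derive_comp a dA dG) /fundamental /dmap.
have nc : \forall c \near (cone R : CC), c != 0 :> CC.
  have h : (fun c : CC => c) @ (cone R : CC) --> (cone R : CC) by exact: cvg_id.
  apply: (cvgr_neq0 _ h); apply/eqP => /(congr1 fst) /= /eqP.
  by rewrite oner_eq0.
apply: near_eq_derive; apply: filterS nc => c cn.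
rewrite /chart_rep /= (act_one hB) /G /= (mfd_chartK hNb pzz).
have ez : p (act c z) = p z by apply: (act_fiber hB).
have tc : triv_dom t (p (act c z)) by rewrite ez.
by rewrite -(triv_equivariant tz cn) -ez (triv_phiK tc).
Qed.

(** Differentiates the identity P G = fst. The point [q] is arbitrary because [local_lift] needs
    this around [q0], not only there. *)
Lemma dP_dG q : (\forall q' \near q, P (G q') = q'.1) ->
  differentiable G q -> differentiable P (G q) ->
  forall u, 'D_('D_u G q) P (G q) = u.1.
Proof.
move=> n dG dP u; rewrite -(derive_comp u dG dP).
have -> : 'D_u (P \o G) q = 'D_u fst q by exact: near_eq_derive.
by rewrite (derive_linear_map q u (f := fst)) // => ?; exact: cvg_fst.
Qed.

Lemma dmap_dG u : dmap p z ('D_u G q0) = u.1.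
Proof.
have Gq : G q0 = w0.
  by have := nbhs_singleton triv_rep_P; rewrite P_w0 Phi_w0.
have H := @dP_dG q0 P_triv_rep (smooth_near_diff triv_rep_smooth).
rewrite Gq in H.
exact: (H (smooth_near_diff P_smooth)).
Qed.

(** Differentiates G (P, Phi) = id. A vector killed by dp is therefore the image of a pure fibre
    direction, which identifies the kernel. *)
Lemma dmap_inj_G v : v = 'D_(dmap p z v, 'D_v Phi w0) G q0.
Proof.
have dP := smooth_near_diff P_smooth; have dF := smooth_near_diff Phi_smooth.
have dpair := differentiable_pair dP dF.
rewrite /dmap -/P -/w0 -(derive_pair v dP dF).
have e : (P w0, Phi w0) = q0 by rewrite P_w0 Phi_w0.
have dG : differentiable G ((fun w => (P w, Phi w)) w0).
  by rewrite e; exact: (smooth_near_diff triv_rep_smooth).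
rewrite -{1}e -(derive_comp v dpair dG) -[LHS](derive_id w0 v).
by apply: near_eq_derive; apply: filterS triv_rep_P => w /= ->.
Qed.

(** The lift is (Y, 0) in the trivialization. It need not be horizontal for a connection;
    subtracting its vertical part later proves horizontal lifts smooth. *)
Lemma local_lift (Y : vfield Nb) : smooth_vf Y (p z) ->
  exists2 W : vfield N, smooth_vf W z & related_at p W Y z.
Proof.
move=> sY.
pose Wc (w : cE E) : cE E := 'D_(vrep Y (p z) (P w), 0) G (P w, Phi w).
have fF := model_frame okF.
have fC : fin_frame CC by apply: fin_frame_prod; exact: fin_frame_R.
have sPP : smooth_near w0 (fun w => (P w, Phi w)).
  by apply: smooth_near_pair; [exact: P_smooth|exact: Phi_smooth].
have e : (P w0, Phi w0) = q0 by rewrite P_w0 Phi_w0.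
have sYP : smooth_near w0 (fun w => vrep Y (p z) (P w)).
  apply: (@smooth_near_comp _ _ _ _ w0 P (vrep Y (p z)) fF P_smooth).
  by rewrite P_w0.
have sWc : smooth_near w0 Wc.
  apply: (@smooth_near_dapp _ _ _ _ w0 (fun w => (P w, Phi w))
     (fun w => (vrep Y (p z) (P w), 0)) G (fin_frame_prod fF fC) sPP).
    by apply: smooth_near_pair => //; exact: smooth_near_cst.
  by rewrite e; exact: triv_rep_smooth.
pose W : vfield N := fun y => dtrans z y y (Wc (chart z y)).
exists W.
  by apply: (smooth_vf_local hN sWc); exact: filterE.
(* The interior is taken since P G = fst has to be differentiated at the nearby points, hence must
   hold around each of them. *)
have nG := nearI (smooth_near_near triv_rep_smooth) (nbhs_interior P_triv_rep).
rewrite -e in nG.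
have n1 := smooth_near_cont sPP nG.
have n2 := nearI n1 (nearI triv_rep_P (smooth_near_near P_smooth)).
have n3 := nearI (near_chart hN zz n2) (nearI (near_dom hN zz)
  (nearI (chart_rep_change hN hNb hp z) (near_preimage hp (near_dom hNb pzz)))).
apply: filterS n3 => y [[[sG iP] [GP sP]] [d [ec d']]].
have yy := mfd_dom_self hN y; have pyy := mfd_dom_self hNb (p y).
have := ec (W y); rewrite {1}/W dtrans_comp// dtrans_id// => e1.
have Pw : P (chart z y) = chart (p z) (p y) by rewrite /P /chart_rep (mfd_chartK hN d).
have e2 : 'D_(Wc (chart z y)) P (chart z y) = vrep Y (p z) (P (chart z y)).
  have := @dP_dG (P (chart z y), Phi (chart z y)) iP (smooth_near_diff sG).
  rewrite GP => H.
  by have := H (smooth_near_diff sP) (vrep Y (p z) (P (chart z y)), 0).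
rewrite -/P e2 Pw vrepE// in e1.
(* Both sides are moved to the chart at [p z], where [e1] compares them, and back. *)
rewrite -[LHS](dtrans_id hNb _ pyy) -[RHS](dtrans_id hNb _ pyy).
by rewrite -(dtrans_comp hNb _ pyy d' pyy) -[RHS](dtrans_comp hNb _ pyy d' pyy) e1.
Qed.
End Trivialization.
End Bundle.

(** * Vertical vectors and horizontal lifts *)

Section Lifts.
Variables (R : realType) (E F : cmodel R).
Variables (okE : cmodel_ok E) (okF : cmodel_ok F).
Variables (N : charted E) (Nb : charted F).
Variables (hN : is_complex_manifold N) (hNb : is_complex_manifold Nb).
Variables (act : cE (C1 R) -> N -> N) (p : N -> Nb).
Variables (hB : holo_principal_bundle act p).
Variables (xi : vfield N) (gen : generated_by act xi).
Hypothesis sxi : forall z, smooth_vf xi z.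
Let CC : normedModType R := cE (C1 R).

Let hp : smooth_map_on setT p. Proof. by case: (proj_holo hB). Qed.

Lemma dmap_proj_J z v : dmap p z (cJ v) = cJ (dmap p z v).
Proof. by have [_ H] := proj_holo hB; exact: (H z I). Qed.

Let dpP z := dmapP hp z.

Lemma fundamentalP z (a : R) (u v : CC) :
  fundamental act (a *: u + v) z = a *: fundamental act u z + fundamental act v z.
Proof.
have [t _ tz] := proj_triv hB (p z).
rewrite !(fundamentalE hNb hB tz) -derive_linear; last first.
  by apply: smooth_near_diff; exact: (triv_rep_smooth tz).
congr ('D__ _ _); rewrite cmulP.
by apply: injective_projections => //=; rewrite scaler0 addr0.
Qed.

Lemma fundamental_xi z (a : CC) :
  fundamental act a z = (a.1 : R) *: xi z + (a.2 : R) *: cJ (xi z).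
Proof.
have [<- <-] := gen z.
have f0 : fundamental act (0 : CC) z = 0.
  by apply: (@lfun0 _ _ _ (fun a : CC => fundamental act a z)) => b u v; exact: fundamentalP.
have e : a = (a.1 : R) *: cone R + ((a.2 : R) *: cimag R + 0) :> CC.
  case: a => a1 a2; rewrite addr0.
  rewrite -[RHS]/((a1 : R) * 1 + (a2 : R) * 0 : R, (a1 : R) * 0 + (a2 : R) * 1 : R).
  by rewrite !mulr1 !mulr0 addr0 add0r.
apply: (etrans (congr1 (fun c => fundamental act c z) e)).
apply: (etrans (fundamentalP _ _ _ _)); congr (_ + _).
apply: (etrans (fundamentalP _ _ _ _)).
by rewrite f0 addr0.
Qed.

Lemma dmap_fundamental z (a : CC) : dmap p z (fundamental act a z) = 0.
Proof.
have [t _ tz] := proj_triv hB (p z).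
by rewrite (fundamentalE hNb hB tz) (dmap_dG hN hNb hB tz).
Qed.

Lemma dmap_xi z : dmap p z (xi z) = 0.
Proof. by have [<- _] := gen z; exact: dmap_fundamental. Qed.

Lemma dmap_Jxi z : dmap p z (cJ (xi z)) = 0.
Proof. by have [_ <-] := gen z; exact: dmap_fundamental. Qed.

Lemma dmap_kernel z v : dmap p z v = 0 -> exists a : CC, v = fundamental act a z.
Proof.
have [t _ tz] := proj_triv hB (p z); move=> v0.
have e := dmap_inj_G hN hNb hB tz v; rewrite v0 in e.
pose c : CC := 'D_v (fun w => triv_phi t (chart_inv z w) : CC) (chart z z).
have [a ea] := cmul_div c (triv_phi_neq0 tz).
by exists a; rewrite (fundamentalE hNb hB tz) ea.
Qed.

Lemma dmap_onto z u : exists v, dmap p z v = u.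
Proof.
have [t _ tz] := proj_triv hB (p z).
by eexists; exact: (dmap_dG hN hNb hB tz (u, 0)).
Qed.

Section Connection10.
Variables (eta : oneform N CC) (he : principal_connection10 act eta).

Let etaP z (a : R) u v : eta z (a *: u + v) = a *: eta z u + eta z v.
Proof. by have [H _] := pconn_oneform he; exact: H. Qed.

Lemma eta_vertical z (a b : R) : eta z (a *: xi z + b *: cJ (xi z)) = (a, b).
Proof. by rewrite -(pconn_fundamental he (a, b) z) fundamental_xi. Qed.

Lemma vertical_unique z u v : dmap p z u = dmap p z v -> eta z u = eta z v -> u = v.
Proof.
move=> ep ee; apply/eqP; rewrite -subr_eq0; apply/eqP.
have [|a ea] := @dmap_kernel z (u - v).
  by rewrite (lfunB (dpP z)) ep subrr.
have : eta z (u - v) = 0 by rewrite (lfunB (@etaP z)) ee subrr.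
rewrite ea (pconn_fundamental he) => ->.
by rewrite fundamental_xi /= !scale0r addr0.
Qed.

Lemma vertical_part z v : dmap p z v = 0 ->
  v = ((eta z v).1 : R) *: xi z + ((eta z v).2 : R) *: cJ (xi z).
Proof.
move=> v0; have [a ea] := dmap_kernel v0.
by rewrite -fundamental_xi ea (pconn_fundamental he).
Qed.

(** Shows that the choice in [hlift_vec] is not the default 0: any lift minus the fundamental vector
    of its [eta]-value is horizontal. *)
Lemma hlift_vecP z u : dmap p z (hlift_vec p eta z u) = u /\ eta z (hlift_vec p eta z u) = 0.
Proof.
have [v ev] := dmap_onto z u.
pose w := v - fundamental act (eta z v) z.
have H : [set v | dmap p z v = u /\ eta z v = 0] w.
  split; first by rewrite (lfunB (dpP z)) ev dmap_fundamental subr0.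
  by rewrite (lfunB (@etaP z)) (pconn_fundamental he) subrr.
exact: (xgetPex 0 (ex_intro _ w H)).
Qed.

Lemma hlift_vec_unique z u v : dmap p z v = u -> eta z v = 0 -> hlift_vec p eta z u = v.
Proof.
move=> e e0; have [h1 h2] := hlift_vecP z u.
exact: (vertical_unique (etrans h1 (esym e)) (etrans h2 (esym e0))).
Qed.

Lemma hlift_vec_linear z (a : R) u v :
  hlift_vec p eta z (a *: u + v) = a *: hlift_vec p eta z u + hlift_vec p eta z v.
Proof.
have [h1 h2] := hlift_vecP z u; have [k1 k2] := hlift_vecP z v.
apply: hlift_vec_unique; first by rewrite dpP h1 k1.
by rewrite etaP h2 k2 scaler0 addr0.
Qed.

Lemma hlift_vec_J z u : hlift_vec p eta z (cJ u) = cJ (hlift_vec p eta z u).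
Proof.
have [h1 h2] := hlift_vecP z u.
apply: hlift_vec_unique; first by rewrite dmap_proj_J h1.
exact: (pconn_type10 he).
Qed.

Lemma eta_smooth1 (V : vfield N) z : smooth_vf V z ->
  smooth_fun (fun y => (eta y (V y)).1 : R^o) z.
Proof.
move=> sV; have [_ H] := pconn_oneform he; have := H V z sV.
rewrite /smooth_fun => s.
have lf : linear (fun c : CC => c.1 : R^o) by [].
pose L : {linear CC -> R^o} := HB.pack (fun c : CC => c.1 : R^o)
  (GRing.isLinear.Build _ _ _ _ _ lf).
have cL : continuous L by move=> x; exact: cvg_fst.
exact: (smooth_near_linear cL s).
Qed.

Lemma eta_smooth2 (V : vfield N) z : smooth_vf V z ->
  smooth_fun (fun y => (eta y (V y)).2 : R^o) z.
Proof.
move=> sV; have [_ H] := pconn_oneform he; have := H V z sV.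
rewrite /smooth_fun => s.
have lf : linear (fun c : CC => c.2 : R^o) by [].
pose L : {linear CC -> R^o} := HB.pack (fun c : CC => c.2 : R^o)
  (GRing.isLinear.Build _ _ _ _ _ lf).
have cL : continuous L by move=> x; exact: cvg_snd.
exact: (smooth_near_linear cL s).
Qed.

Lemma smooth_vertical (f g : N -> R^o) z : smooth_fun f z -> smooth_fun g z ->
  smooth_vf (fun y => (f y : R) *: xi y + (g y : R) *: cJ (xi y)) z.
Proof.
move=> sf sg; apply: (smooth_vfD hN).
  exact: (smooth_vfZ hN sf (sxi z)).
exact: (smooth_vfZ hN sg (smooth_vfJ okE hN (sxi z))).
Qed.

(** Near [z], uniqueness identifies the horizontal lift with a smooth local lift minus its vertical
    part, whose coefficients are smooth because [eta] is. *)
Lemma hlift_smooth (Y : vfield Nb) z : smooth_vf Y (p z) -> smooth_vf (hlift p eta Y) z.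
Proof.
move=> sY; have [t _ tz] := proj_triv hB (p z).
have [W sW rW] := local_lift okF hN hNb hB tz sY.
have s := smooth_vfB hN sW (smooth_vertical (eta_smooth1 sW) (eta_smooth2 sW)).
apply: (smooth_vf_ext hN _ s); apply: filterS rW => y e.
rewrite /hlift; apply/esym; apply: hlift_vec_unique.
  by rewrite (lfunB (dpP y)) e -fundamental_xi dmap_fundamental subr0.
rewrite (lfunB (@etaP y)) eta_vertical.
by case: (eta y (W y)) => c1 c2 /=; rewrite subrr.
Qed.

(* A c-projective change of the induced connection is a change of the lift. *)
Variables (a : oneform Nb R^o) (ha : is_oneform a).

Definition clift (z : N) (u : cE F) : cE E :=
  hlift_vec p eta z u + (a (p z) u : R) *: xi z - (a (p z) (cJ u) : R) *: cJ (xi z).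

Let aP b (c : R) u v : a b (c *: u + v) = c * a b u + a b v.
Proof. by have [H _] := ha; exact: H. Qed.

Lemma clift_linear z (c : R) u v : clift z (c *: u + v) = c *: clift z u + clift z v.
Proof.
rewrite /clift hlift_vec_linear (cJP okF) !aP.
by apply: (Jseparates okE) => L LD LN LZ; rewrite !(LD, LN, LZ); ring.
Qed.

Lemma clift_J z u : clift z (cJ u) = cJ (clift z u).
Proof.
rewrite /clift hlift_vec_J (model_JJ okF) (cJB okE) (cJD okE) !(cJZ okE) (model_JJ okE).
have -> : a (p z) (- u) = - a (p z) u.
  exact: (@lfunN _ _ _ (a (p z)) (@aP (p z))).
by rewrite scalerN opprK scaleNr opprK -addrA [X in _ + X]addrC addrA.
Qed.

Lemma clift_proj z u : dmap p z (clift z u) = u.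
Proof.
rewrite /clift (lfunB (dpP z)) (lfunD (dpP z)) !(lfunZ (dpP z)) dmap_xi dmap_Jxi.
by rewrite !scaler0 addr0 subr0; have [] := hlift_vecP z u.
Qed.

Lemma clift_smooth (Y : vfield Nb) z : smooth_vf Y (p z) ->
  smooth_vf (fun y => clift y (Y (p y))) z.
Proof.
move=> sY; have sJY := smooth_vfJ okF hNb sY; have [_ sa] := ha.
have s1 := smooth_fun_pull okF hN hNb hp (sa _ _ sY).
have s2 := smooth_fun_pull okF hN hNb hp (sa _ _ sJY).
apply: (smooth_vfB hN).
  by apply: (smooth_vfD hN (hlift_smooth sY)); exact: (smooth_vfZ hN s1 (sxi z)).
exact: (smooth_vfZ hN s2 (smooth_vfJ okE hN (sxi z))).
Qed.
End Connection10.
End Lifts.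

(** * Curvature of the induced connection *)

Section InducedCurvature.
Variables (R : realType) (E F : cmodel R).
Variables (okE : cmodel_ok E) (okF : cmodel_ok F).
Variables (N : charted E) (Nb : charted F).
Variables (hN : is_complex_manifold N) (hNb : is_complex_manifold Nb).
Variables (act : cE (C1 R) -> N -> N) (p : N -> Nb).
Variables (hB : holo_principal_bundle act p).
Variables (nabla : covop N) (xi : vfield N).
Hypotheses (hC : conical_special_complex nabla xi) (gen : generated_by act xi).
Let CC : normedModType R := cE (C1 R).
Variables (eta : oneform N CC) (he : principal_connection10 act eta).
Variables (h : N -> cE F -> cE E).
Hypothesis h_linear : forall z (a : R) u v, h z (a *: u + v) = a *: h z u + h z v.
Hypothesis h_J : forall z u, h z (cJ u) = cJ (h z u).
Hypothesis h_proj : forall z u, dmap p z (h z u) = u.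
Let hv (Y : vfield Nb) : vfield N := fun y => h y (Y (p y)).
Hypothesis h_smooth : forall (Y : vfield Nb) z, smooth_vf Y (p z) -> smooth_vf (hv Y) z.
Variables (D : covop Nb) (hD : is_connection D) (tfD : torsion_free D).
Hypothesis hind : forall (Y : vfield Nb) z, smooth_vf Y (p z) -> forall u,
  D Y (p z) u = dmap p z (covprime nabla (hv Y) z (h z u)).

Let hS : special_complex nabla. Proof. by case: hC. Qed.
Let sxi z : smooth_vf xi z. Proof. by case: hC. Qed.
Let hp : smooth_map_on setT p. Proof. by case: (proj_holo hB). Qed.
Let nab := covprime nabla.
Let hnab : is_connection nab. Proof. exact: covprime_connection. Qed.
Let tnab : torsion_free nab. Proof. exact: covprime_torsion_free. Qed.
Let dpP z := dmapP hp z.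
Let etaP z (a : R) u v : eta z (a *: u + v) = a *: eta z u + eta z v.
Proof. by have [H _] := pconn_oneform he; exact: H. Qed.

(* The vertical part of [nabla'_{hX} hY]. *)
Definition vert (Y : vfield Nb) (z : N) (u : cE F) : cE E :=
  nab (hv Y) z (h z u) - h z (D Y (p z) u).

Lemma dmap_vert Y z u : smooth_vf Y (p z) -> dmap p z (vert Y z u) = 0.
Proof. by move=> sY; rewrite (lfunB (dpP z)) h_proj -hind// subrr. Qed.

Lemma vertE Y z u : smooth_vf Y (p z) ->
  vert Y z u = ((eta z (vert Y z u)).1 : R) *: xi z + ((eta z (vert Y z u)).2 : R) *: cJ (xi z).
Proof. by move=> sY; apply: (vertical_part hN hNb hB gen he); exact: dmap_vert. Qed.

(** By torsion-freeness the two sides differ by the projection of [V, Z]; as brackets of related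
    fields are related, this is [0, Zb] = 0. *)
Lemma dmap_nab_vertical (V : vfield N) Z z (Zb : vfield Nb) : smooth_vf V z ->
  smooth_vf Zb (p z) -> smooth_vf Z z -> related_at p Z Zb z ->
  related_at p V (fun=> 0) z ->
  dmap p z (nab Z z (V z)) = dmap p z (nab V z (Z z)).
Proof.
move=> sV sZb sZ rZ rV.
have e : nab Z z (V z) = nab V z (Z z) + lie V Z z.
  by rewrite -(tnab sV sZ) addrC subrK.
rewrite e (lfunD (dpP z)) (lie_related okE okF hN hNb hp sV sZ (smooth_vf0 hNb _) sZb rV rZ).
rewrite /lie derive0.
have -> : vrep (fun=> 0) (p z) = cst (0 : cE F) :> (cE F -> cE F).
  by apply/funext => w; rewrite /vrep /tcoord derive0.
by rewrite derive_cst subrr addr0.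
Qed.

Lemma related_hv (Y : vfield Nb) z : related_at p (hv Y) Y z.
Proof. by apply: filterE => y; exact: h_proj. Qed.

(** After the exchange of the two fields, nabla' xi = id and nabla' (J xi) = J apply. This is how
    vertical directions contribute terms in Z and JZ to the base. *)
Lemma dmap_nab_xi Z z (a b : R) : smooth_vf Z (p z) ->
  dmap p z (nab (hv Z) z (a *: xi z + b *: cJ (xi z))) = a *: Z (p z) + b *: cJ (Z (p z)).
Proof.
move=> sZ; have shZ := h_smooth sZ; have sJ := smooth_vfJ okE hN (sxi z).
rewrite (conn_linear hnab shZ) (dpP z); congr (_ *: _ + _).
  rewrite (dmap_nab_vertical (sxi z) sZ shZ (related_hv Z z)); last first.
    by apply: filterE => y; exact: (dmap_xi hN hNb hB gen).
  by rewrite /nab (covprime_xi okE hN hS hC) h_proj.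
have -> : nab (hv Z) z (b *: cJ (xi z)) = b *: nab (hv Z) z (cJ (xi z)).
  exact: (@lfunZ _ _ _ (nab (hv Z) z) (conn_linear hnab shZ)).
rewrite (lfunZ (dpP z)); congr (_ *: _).
have -> : dmap p z (nab (hv Z) z (cJ (xi z))) = dmap p z (nab (fun y => cJ (xi y)) z (hv Z z)).
  rewrite -(dmap_nab_vertical (V := fun y => cJ (xi y)) sJ sZ shZ (related_hv Z z))//.
  by apply: filterE => y; exact: (dmap_Jxi hN hNb hB gen).
by rewrite /nab (covprime_Jxi okE hN hS hC) (dmap_proj_J hB) h_proj.
Qed.

(** The lift of D_Y Z is nabla'_{hY} hZ minus a vertical field f xi + g J xi. Differentiated along
    hX, the derivatives of f and g multiply vertical vectors and vanish under projection, leaving f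
    X + g JX. *)
Lemma induced_second X Y Z z : smooth_vf X (p z) -> smooth_vf Y (p z) ->
  smooth_vf Z (p z) ->
  D (fun b => D Z b (Y b)) (p z) (X (p z)) =
  dmap p z (nab (fun y => nab (hv Z) y (hv Y y)) z (hv X z))
  - (((eta z (vert Z z (Y (p z)))).1 : R) *: X (p z)
     + ((eta z (vert Z z (Y (p z)))).2 : R) *: cJ (X (p z))).
Proof.
move=> sX sY sZ.
have sXl := h_smooth sX; have sYl := h_smooth sY; have sZl := h_smooth sZ.
pose W : vfield Nb := fun b => D Z b (Y b).
have sW : smooth_vf W (p z) by exact: (conn_smooth hD).
have sWl := h_smooth sW.
pose U : vfield N := fun y => nab (hv Z) y (hv Y y).
have sU : smooth_vf U z by exact: (conn_smooth hnab).
pose V : vfield N := fun y => U y - hv W y.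
have sV : smooth_vf V z by exact: smooth_vfB.
pose f : N -> R^o := fun y => (eta y (V y)).1.
pose g : N -> R^o := fun y => (eta y (V y)).2.
have sf : smooth_fun f z by exact: (eta_smooth1 he).
have sg : smooth_fun g z by exact: (eta_smooth2 he).
have sJ := smooth_vfJ okE hN (sxi z).
pose V1 : vfield N := fun y => (f y : R) *: xi y.
pose V2 : vfield N := fun y => (g y : R) *: cJ (xi y).
have sV1 : smooth_vf V1 z by exact: (smooth_vfZ hN sf (sxi z)).
have sV2 : smooth_vf V2 z by exact: (smooth_vfZ hN sg sJ).
have sV12 : smooth_vf (fun y => V1 y + V2 y) z by exact: smooth_vfD.
(* [Z] is smooth only near [p z], so the splitting is known only near [z]; a connection depends on
   no more than the germ. *)
have nW : \forall y \near z, U y - (V1 y + V2 y) = hv W y.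
  have n := near_preimage hp (smooth_vf_near okF hNb sZ).
  apply: filterS n => y sZy.
  by rewrite -[V1 y + V2 y](vertE (Y (p y)) sZy) opprB addrC subrK.
have e : nab (hv W) z (hv X z) = nab U z (hv X z) -
    (nab V1 z (hv X z) + nab V2 z (hv X z)).
  rewrite -(connD hnab _ sV1 sV2) -(connB hN hnab _ sU sV12).
  by apply/esym; apply: (conn_germ hN hnab) => //; exact: smooth_vfB.
rewrite -[LHS]/(D W (p z) (X (p z))) hind// -/nab e (lfunB (dpP z)); congr (_ - _).
rewrite (lfunD (dpP z)); congr (_ + _).
  rewrite (conn_leibniz hnab sf (sxi z)) (dpP z) (lfunZ (dpP z)).
  by rewrite (dmap_xi hN hNb hB gen) scaler0 addr0 /nab (covprime_xi okE hN hS hC) h_proj.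
rewrite (conn_leibniz hnab sg sJ) (dpP z) (lfunZ (dpP z)).
rewrite (dmap_Jxi hN hNb hB gen) scaler0 addr0 /nab (covprime_Jxi okE hN hS hC).
by rewrite (dmap_proj_J hB) h_proj.
Qed.

(** Torsion-freeness of both connections shows that h[X, Y] and [hX, hY] differ by the skew part of
    [vert]; [dmap_nab_xi] evaluates the derivative along this vertical vector. *)
Lemma induced_lie X Y Z z : smooth_vf X (p z) -> smooth_vf Y (p z) ->
  smooth_vf Z (p z) ->
  D Z (p z) (lie X Y (p z)) =
  dmap p z (nab (hv Z) z (lie (hv X) (hv Y) z))
  - (((eta z (vert Y z (X (p z)))).1 - (eta z (vert X z (Y (p z)))).1 : R) *: Z (p z)
     + ((eta z (vert Y z (X (p z)))).2 - (eta z (vert X z (Y (p z)))).2 : R) *: cJ (Z (p z))).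
Proof.
move=> sX sY sZ.
have sXl := h_smooth sX; have sYl := h_smooth sY; have sZl := h_smooth sZ.
rewrite hind// -/nab.
set c := eta z (vert Y z _); set d := eta z (vert X z _).
have e : h z (lie X Y (p z)) = lie (hv X) (hv Y) z -
    ((c.1 - d.1 : R) *: xi z + (c.2 - d.2 : R) *: cJ (xi z)).
  have e1 := vertE (X (p z)) sY; have e2 := vertE (Y (p z)) sX.
  rewrite -/c in e1; rewrite -/d in e2.
  have -> : h z (lie X Y (p z)) = lie (hv X) (hv Y) z - (vert Y z (X (p z)) - vert X z (Y (p z))).
    rewrite -(tnab sXl sYl) -(tfD sX sY) (lfunB (h_linear z)) /vert /hv.
    by rewrite -/nab; apply: (Jseparates okE) => L LD LN LZ; rewrite !(LD, LN, LZ); ring.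
  congr (_ - _); rewrite e1 e2.
  by apply: (Jseparates okE) => L LD LN LZ; rewrite !(LD, LN, LZ); ring.
rewrite e -(dmap_nab_xi _ _ sZ) -(lfunB (dpP z)).
by rewrite (@lfunB _ _ _ (nab (hv Z) z) (conn_linear hnab sZl)).
Qed.

Lemma vert_linear_l Y z (a : R) u v : smooth_vf Y (p z) ->
  vert Y z (a *: u + v) = a *: vert Y z u + vert Y z v.
Proof.
move=> sY; rewrite /vert h_linear (conn_linear hnab (h_smooth sY)) (conn_linear hD sY) h_linear.
by apply: (Jseparates okE) => L LD LN LZ; rewrite !(LD, LN, LZ); ring.
Qed.

(** Used because [ext] is linear and commutes with J only near its base point. *)
Lemma vert_local X Y z u : smooth_vf X (p z) -> (\forall b \near p z, X b = Y b) ->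
  vert X z u = vert Y z u.
Proof.
move=> sX e; rewrite /vert (conn_germ hNb hD u sX e); congr (_ - _).
apply: (conn_germ hN hnab _ (h_smooth sX)).
by apply: filterS (near_preimage hp e) => y ey; rewrite /hv ey.
Qed.

Lemma vert_linear_r X Y z (a : R) u : smooth_vf X (p z) -> smooth_vf Y (p z) ->
  vert (fun b => a *: X b + Y b) z u = a *: vert X z u + vert Y z u.
Proof.
move=> sX sY; have sXl := h_smooth sX; have sYl := h_smooth sY.
have saX := smooth_vfZc hNb a sX; have saXl := smooth_vfZc hN a sXl.
rewrite /vert (connD hD _ saX sY) (connZ hD _ _ sX) h_linear.
have -> : hv (fun b => a *: X b + Y b) = (fun y => a *: hv X y + hv Y y).
  by apply/funext => y; rewrite /hv h_linear.
rewrite (connD hnab _ saXl sYl) (connZ hnab _ _ sXl).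
by apply: (Jseparates okE) => L LD LN LZ; rewrite !(LD, LN, LZ); ring.
Qed.

Lemma vert_J X z u : smooth_vf X (p z) ->
  vert (fun b => cJ (X b)) z u = cJ (vert X z u).
Proof.
move=> sX; have sXl := h_smooth sX; have sJ := smooth_vfJ okF hNb sX.
have ehv : hv (fun b => cJ (X b)) = (fun y => cJ (hv X y)).
  by apply/funext => y; rewrite /hv h_J.
rewrite /vert hind// /nab ehv (covprime_J okE hN hS)// (dmap_proj_J hB) h_J.
by rewrite -hind// (cJB okE).
Qed.

(** Its two components are the coefficients f of xi and g of J xi. *)
Definition cvert z (u v : cE F) : CC := eta z (vert (ext (p z) v) z u).

Lemma cvert_linear_l z (a : R) u u' v :
  cvert z (a *: u + u') v = a *: cvert z u v + cvert z u' v.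
Proof. by rewrite /cvert vert_linear_l ?etaP//; exact: smooth_vf_const. Qed.

Lemma cvert_linear_r z (a : R) u v v' :
  cvert z u (a *: v + v') = a *: cvert z u v + cvert z u v'.
Proof.
have s w := smooth_vf_const hNb (p z) w.
rewrite /cvert -etaP -vert_linear_r//; congr (eta z _).
apply: vert_local => //; exact: ext_nearP.
Qed.

(** Multiplication by i: nabla', [h] and hence D commute with J in the differentiated slot. This
    expresses g through [Qform]. *)
Lemma cvert_J z u v : cvert z u (cJ v) = (- ((cvert z u v).2 : R), ((cvert z u v).1 : R)).
Proof.
have s w := smooth_vf_const hNb (p z) w.
rewrite /cvert (vert_local u (s (cJ v)) (ext_nearJ hNb (p z) v)) vert_J//.
rewrite {1}(vertE u (s v)) (cJD okE) !(cJZ okE) (model_JJ okE).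
set c := eta z (vert _ z u).
rewrite scalerN addrC -scaleNr.
exact: (eta_vertical hNb hB gen he).
Qed.

Definition Qform z (u v : cE F) : R := (cvert z u v).1.

Lemma Qform_linear_l z (a : R) u u' v :
  Qform z (a *: u + u') v = a * Qform z u v + Qform z u' v.
Proof. by rewrite /Qform cvert_linear_l. Qed.

Lemma Qform_linear_r z (a : R) u v v' :
  Qform z u (a *: v + v') = a * Qform z u v + Qform z u v'.
Proof. by rewrite /Qform cvert_linear_r. Qed.

Lemma cvert2 z u v : (cvert z u v).2 = - Qform z u (cJ v) :> R.
Proof. by rewrite /Qform cvert_J /= opprK. Qed.

(** A pushed down at the point [z]. Lacking the factor e^(2 theta J), it may vary along the fibre,
    so it is indexed by [z] and not by [p z]. *)
Definition Bform z (u v : cE F) : cE F := dmap p z (covJ nabla z (h z u) (h z v)).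

Lemma covJ_vertical z w (a b : R) : covJ nabla z w (a *: xi z + b *: cJ (xi z)) = 0.
Proof.
rewrite (covJ_linear_r okE hN hS).
rewrite (@lfunZ _ _ _ (covJ nabla z w) (fun a u v => covJ_linear_r okE hN hS z a w u v)).
by rewrite (covJ_Jr okE hN hS) (covJ_xi okE hN hS hC) (cJ0 okE) oppr0 !scaler0 addr0.
Qed.

(** A annihilates xi and J xi, which span the kernel of dp; thus A descends whatever lifts are
    used. *)
Lemma covJ_lift z w v v' : dmap p z v = dmap p z v' -> covJ nabla z w v = covJ nabla z w v'.
Proof.
move=> e; have [|a ea] := @dmap_kernel _ _ _ _ _ hN hNb _ _ hB z (v - v').
  by rewrite (lfunB (dpP z)) e subrr.
have L := fun a u v => covJ_linear_r okE hN hS z a w u v.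
apply/eqP; rewrite -subr_eq0 -(@lfunB _ _ _ (covJ nabla z w) L) ea.
by rewrite (fundamental_xi hNb hB gen) covJ_vertical.
Qed.

Lemma dmap_covJ z u v : dmap p z (covJ nabla z u v) = Bform z (dmap p z u) (dmap p z v).
Proof.
have e w : dmap p z w = dmap p z (h z (dmap p z w)) by rewrite h_proj.
rewrite (covJ_lift u (e v)) (covJC hS z u) (covJ_lift _ (e u)).
by rewrite (covJC hS z _ (h z (dmap p z u))).
Qed.

Lemma BformC z u v : Bform z u v = Bform z v u.
Proof. by rewrite /Bform (covJC hS). Qed.

Lemma Bform_linear z (a : R) u v w : Bform z u (a *: v + w) = a *: Bform z u v + Bform z u w.
Proof. by rewrite /Bform h_linear (covJ_linear_r okE hN hS) (dpP z). Qed.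

Lemma BformJ z u v : Bform z u (cJ v) = - cJ (Bform z u v).
Proof.
by rewrite /Bform h_J (covJ_Jr okE hN hS) (lfunN (dpP z)) (dmap_proj_J hB).
Qed.

Lemma induced_curvature z u v w :
  Rm D (p z) u v w =
  - 4^-1 *: (Bform z u (Bform z v w) - Bform z v (Bform z u w))
  - (Qform z v w *: u - Qform z v (cJ w) *: cJ u)
  + (Qform z u w *: v - Qform z u (cJ w) *: cJ v)
  + ((Qform z u v - Qform z v u) *: w - (Qform z u (cJ v) - Qform z v (cJ u)) *: cJ w).
Proof.
have s b := smooth_vf_const hNb (p z) b.
have su := s u; have sv := s v; have sw := s w.
have es b : ext (p z) b (p z) = b := ext_self hNb (p z) b.
have e1 := induced_second su sv sw; have e2 := induced_second sv su sw.
have e3 := induced_lie su sv sw.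
rewrite /Rm /curv e1 e2 e3 !es -!/(cvert z _ _) !cvert2.
have eB a b : dmap p z (a - b) = dmap p z a - dmap p z b := lfunB (dpP z) a b.
pose X := hv (ext (p z) u); pose Y := hv (ext (p z) v); pose Z := hv (ext (p z) w).
have ec : dmap p z (nab (fun y => nab Z y (Y y)) z (X z)) -
    dmap p z (nab (fun y => nab Z y (X y)) z (Y z)) - dmap p z (nab Z z (lie X Y z)) =
    - 4^-1 *: (Bform z u (Bform z v w) - Bform z v (Bform z u w)).
  rewrite -!(lfunB (dpP z)).
  apply: (etrans (congr1 (dmap p z) (covprime_curv okE hN hS (h_smooth su) (h_smooth sv) (h_smooth sw)))).
  apply: (etrans (lfunZ (dpP z) _ _)); congr (_ *: _).
  rewrite [LHS]eB [in LHS](dmap_covJ z (X z)) [in LHS](dmap_covJ z (Y z)) !dmap_covJ.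
  by rewrite /X /Y /Z /hv !es !h_proj.
exact: (induced_curvature_identity okF _ _ _ _ _ _ _ _ _ _ _ _ _ _ ec).
Qed.
End InducedCurvature.

(** * c-projective changes as changes of the lift *)

Section CprojChange.
Variables (R : realType) (E F : cmodel R).
Variables (okE : cmodel_ok E) (okF : cmodel_ok F).
Variables (N : charted E) (Nb : charted F).
Variables (hN : is_complex_manifold N) (hNb : is_complex_manifold Nb).
Variables (act : cE (C1 R) -> N -> N) (p : N -> Nb).
Variables (hB : holo_principal_bundle act p).
Variables (nabla : covop N) (xi : vfield N).
Hypotheses (hC : conical_special_complex nabla xi) (gen : generated_by act xi).
Variables (eta : oneform N (cE (C1 R))) (he : principal_connection10 act eta).
Variables (a : oneform Nb R^o) (ha : is_oneform a).

Let hS : special_complex nabla. Proof. by case: hC. Qed.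
Let sxi z : smooth_vf xi z. Proof. by case: hC. Qed.
Let hp : smooth_map_on setT p. Proof. by case: (proj_holo hB). Qed.
Let hnab : is_connection (covprime nabla). Proof. exact: covprime_connection. Qed.
Let dpP z := dmapP hp z.

(** The change of the direction acts through [dmap_nab_xi] and gives a(u) Y - a(Ju) JY. The change
    of the field, a(Y) xi - a(JY) J xi, gives a(Y) u - a(JY) Ju, since derivatives of its
    coefficients multiply vertical vectors. *)
Lemma clift_induced (Y : vfield Nb) z u : smooth_vf Y (p z) ->
  dmap p z (covprime nabla (fun y => clift p xi eta a y (Y (p y))) z (clift p xi eta a z u)) =
  dmap p z (covprime nabla (hlift p eta Y) z (hlift_vec p eta z u))
  + (a (p z) u : R) *: Y (p z) + (a (p z) (Y (p z)) : R) *: u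
  - (a (p z) (cJ u) : R) *: cJ (Y (p z)) - (a (p z) (cJ (Y (p z))) : R) *: cJ u.
Proof.
move=> sY; have sJY := smooth_vfJ okF hNb sY; have [_ sa] := ha.
have s1 : smooth_fun (fun y => a (p y) (Y (p y))) z.
  exact: (smooth_fun_pull okF hN hNb hp (sa _ _ sY)).
have s2 : smooth_fun (fun y => a (p y) (cJ (Y (p y)))) z.
  exact: (smooth_fun_pull okF hN hNb hp (sa _ _ sJY)).
have sh := hlift_smooth okE okF hN hNb hB gen sxi he sY.
have sJ := smooth_vfJ okE hN (sxi z).
have sV1 := smooth_vfZ hN s1 (sxi z); have sV2 := smooth_vfZ hN s2 sJ.
pose w := clift p xi eta a z u.
have pw : dmap p z w = u by exact: (clift_proj hN hNb hB gen he).
have e1 : dmap p z (covprime nabla (fun y => (a (p y) (Y (p y)) : R) *: xi y) z w) =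
    (a (p z) (Y (p z)) : R) *: u.
  rewrite (conn_leibniz hnab s1 (sxi z)) (dpP z) (lfunZ (dpP z)).
  by rewrite (dmap_xi hN hNb hB gen) scaler0 addr0 (covprime_xi okE hN hS hC) pw.
have e2 : dmap p z (covprime nabla (fun y => (a (p y) (cJ (Y (p y))) : R) *: cJ (xi y)) z w) =
    (a (p z) (cJ (Y (p z))) : R) *: cJ u.
  rewrite (conn_leibniz hnab s2 sJ) (dpP z) (lfunZ (dpP z)).
  rewrite (dmap_Jxi hN hNb hB gen) scaler0 addr0 (covprime_Jxi okE hN hS hC).
  by rewrite (dmap_proj_J hB) pw.
rewrite /clift -/(clift p xi eta a z u) -/w.
rewrite (connB hN hnab _ (smooth_vfD hN sh sV1) sV2) (connD hnab _ sh sV1).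
rewrite (lfunB (dpP z)) (lfunD (dpP z)) e1 e2.
have -> : w = hlift_vec p eta z u + ((a (p z) u : R) *: xi z + (- (a (p z) (cJ u) : R)) *: cJ (xi z)).
  by rewrite /w /clift scaleNr addrA.
rewrite (lfunD (conn_linear hnab sh)) (lfunD (dpP z)).
have hpr y v : dmap p y (hlift_vec p eta y v) = v by have [] := hlift_vecP hN hNb hB he y v.
rewrite (dmap_nab_xi okE okF hN hNb hB hC gen (h := hlift_vec p eta))//; last first.
  by move=> Z y; exact: (hlift_smooth okE okF hN hNb hB gen sxi he).
rewrite scaleNr; congr (_ - _).
by rewrite addrA [LHS]addrAC.
Qed.
End CprojChange.

(** * The c-projective Weyl curvature *)

Section Trace.
Variables (R : realType) (n : nat).
Let T := cE (Cn R n).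
Implicit Types (f g : T -> T).

Lemma Cn_ok : cmodel_ok (Cn R n).
Proof.
split.
- exact: fin_frame_rV.
- have lJ : linear (@cJ R (Cn R n) : 'rV[R]_(n + n) -> 'rV[R]_(n + n)).
    move=> a u v; rewrite /cJ /= scale_row_mx add_row_mx.
    by congr row_mx; rewrite ?linearN !linearD !linearZ//= ?opprD ?scalerN.
  by exists (HB.pack_for {linear 'rV[R]_(n + n) -> 'rV[R]_(n + n)} (@cJ R (Cn R n) : 'rV[R]_(n + n) -> 'rV[R]_(n + n)) (GRing.isLinear.Build _ _ _ _ _ lJ)).
- move=> v; rewrite /cJ /= row_mxKr row_mxKl.
  by rewrite -opp_row_mx hsubmxK.
Qed.

Lemma trE f : tr f = \sum_i (f (delta_mx 0 i) : 'rV[R]_(n + n)) 0 i.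
Proof. by rewrite /tr /mxtrace; apply: eq_bigr => i _; rewrite mxE. Qed.

Lemma tr_linear (a : R) f g : tr (fun x => a *: f x + g x) = a * tr f + tr g.
Proof.
rewrite !trE mulr_sumr -big_split; apply: eq_bigr => i _.
by rewrite !mxE.
Qed.

Lemma tr_rank1 (k : T -> R) v : (forall (a : R) u u', k (a *: u + u') = a * k u + k u') ->
  tr (fun u => k u *: v) = k v.
Proof.
move=> kP; rewrite trE.
pose L : T -> R^o := k.
rewrite [v in RHS](row_sum_delta v).
have Ls (s : seq 'I_(n + n)) : k (\sum_(i <- s) (v : 'rV[R]_(n + n)) 0 i *: delta_mx 0 i) =
    \sum_(i <- s) (v : 'rV[R]_(n + n)) 0 i * k (delta_mx 0 i).
  elim: s => [|i s IH]; first by rewrite !big_nil; exact: (@lfun0 _ _ _ L kP).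
  by rewrite !big_cons kP IH.
by rewrite Ls; apply: eq_bigr => i _; rewrite mxE mulrC.
Qed.

Lemma tr_comp f g : (forall (a : R) u v, f (a *: u + v) = a *: f u + f v) ->
  tr (fun u => f (g u)) =
  \sum_i \sum_j (g (delta_mx 0 i) : 'rV[R]_(n + n)) 0 j * (f (delta_mx 0 j) : 'rV[R]_(n + n)) 0 i.
Proof.
move=> fP; rewrite trE; apply: eq_bigr => i _.
rewrite [g _ in LHS](row_sum_delta (g (delta_mx 0 i))).
suff Ls (s : seq 'I_(n + n)) : (f (\sum_(j <- s) (g (delta_mx 0 i) : 'rV[R]_(n + n)) 0 j *: delta_mx 0 j) : 'rV[R]_(n + n)) 0 i =
    \sum_(j <- s) (g (delta_mx 0 i) : 'rV[R]_(n + n)) 0 j * (f (delta_mx 0 j) : 'rV[R]_(n + n)) 0 i.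
  exact: Ls.
elim: s => [|j s IH].
  by rewrite !big_nil (lfun0 fP) mxE.
by rewrite !big_cons fP -IH !mxE.
Qed.

Lemma trC f g : (forall (a : R) u v, f (a *: u + v) = a *: f u + f v) ->
  (forall (a : R) u v, g (a *: u + v) = a *: g u + g v) ->
  tr (fun u => f (g u)) = tr (fun u => g (f u)).
Proof.
move=> fP gP; rewrite (tr_comp _ fP) (tr_comp _ gP) exchange_big.
by apply: eq_bigr => i _; apply: eq_bigr => j _; rewrite mulrC.
Qed.

Lemma tr_id : tr (fun u : T => u) = (n + n)%:R.
Proof.
rewrite trE (eq_bigr (fun=> 1)) ?sumr_const ?card_ord// => i _.
by rewrite mxE !eqxx.
Qed.

Lemma tr_J : tr (@cJ R (Cn R n)) = 0.
Proof.
rewrite trE big_split_ord /= !big1 ?addr0// => i _.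
  by rewrite [LHS]row_mxEr !mxE eq_lrshift andbF.
by rewrite [LHS]row_mxEl !mxE eq_rlshift andbF oppr0.
Qed.

(** Anticommutation gives f = J f J, whereas by cyclicity J f J has the trace of f J J = - f. *)
Lemma tr_anti f : (forall (a : R) u v, f (a *: u + v) = a *: f u + f v) ->
  (forall u, f (cJ u) = - cJ (f u)) -> tr f = 0.
Proof.
move=> fP fJ.
have JP (a : R) u v : cJ (a *: u + v : T) = a *: cJ u + cJ v := cJP Cn_ok a u v.
have e : tr f = tr (fun u => cJ (f (cJ u))).
  by congr tr; apply/funext => u; rewrite fJ (cJN Cn_ok) (model_JJ Cn_ok) opprK.
have e2 : tr (fun u => cJ (f (cJ u))) = tr (fun u => f (cJ (cJ u))).
  apply: (@trC (@cJ R (Cn R n)) (fun u => f (cJ u))) => // a u v.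
  by rewrite JP fP.
have e3 : tr (fun u => f (cJ (cJ u))) = - tr f.
  have := tr_linear (-1) f (fun=> 0); rewrite [tr (fun=> 0)]trE big1 => [|i _]; last by rewrite mxE.
  rewrite addr0 mulN1r => <-; congr tr; apply/funext => u.
  by rewrite (model_JJ Cn_ok) (lfunN fP) addr0 scaleN1r.
apply/eqP; rewrite -[_ == 0](@mulrn_eq0 _ _ 2)/= mulr2n {2}e e2 e3 subrr.
by [].
Qed.
End Trace.

(** * Pointwise algebra of the Ricci, Rho and Weyl tensors *)

Section WeylAlgebra.
Variables (R : realType) (n : nat) (M : complex_manifold R n) (D : covop M) (x : M).
Hypothesis n_ge2 : (2 <= n)%N.
Let T := cE (Cn R n).
Variables (B : T -> T -> T) (Q : T -> T -> R).
Hypothesis BP : forall (a : R) u v w, B u (a *: v + w) = a *: B u v + B u w.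
Hypothesis BC : forall u v, B u v = B v u.
Hypothesis BJ : forall u v, B u (cJ v) = - cJ (B u v).
Hypothesis QPl : forall (a : R) u u' v, Q (a *: u + u') v = a * Q u v + Q u' v.
Hypothesis QPr : forall (a : R) u v v', Q u (a *: v + v') = a * Q u v + Q u v'.
(* The terms in [Q] are [W - R] with [P^D] replaced by [2 Q]. *)
Hypothesis curvE : forall u v w, Rm D x u v w =
  - 4^-1 *: (B u (B v w) - B v (B u w))
  - (Q v w *: u - Q v (cJ w) *: cJ u)
  + (Q u w *: v - Q u (cJ w) *: cJ v)
  + ((Q u v - Q v u) *: w - (Q u (cJ v) - Q v (cJ u)) *: cJ w).

Let JP (a : R) (u v : T) : cJ (a *: u + v) = a *: cJ u + cJ v := cJP (Cn_ok R n) a u v.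
Let JJ (u : T) : cJ (cJ u) = - u := model_JJ (Cn_ok R n) u.
Let QNl u v : Q (- u) v = - Q u v.
Proof. exact: (@lfunN _ _ _ (fun u => Q u v : R^o) (fun a u u' => QPl a u u' v)). Qed.
Let QNr u v : Q u (- v) = - Q u v.
Proof. exact: (@lfunN _ _ _ (Q u : _ -> R^o) (fun a v v' => QPr a u v v')). Qed.
Let BN u v : B u (- v) = - B u v.
Proof. exact: (lfunN (fun a v w => BP a u v w)). Qed.

Definition Btrace (u v : T) : R := tr (fun w => B u (B v w)).

Lemma BtraceC u v : Btrace u v = Btrace v u.
Proof. by apply: trC => a y z; exact: BP. Qed.

(** By symmetry B_Ju = - J B_u, so the product is J B_u J B_v = - J J B_u B_v. *)
Lemma B_JJ u v w : B (cJ u) (B (cJ v) w) = B u (B v w).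
Proof.
rewrite (BC (cJ v)) BJ BN BJ opprK (BC (cJ u)) BJ (cJN (Cn_ok R n)) JJ opprK.
by rewrite (BC _ u) (BC w).
Qed.

Lemma Btrace_JJ u v : Btrace (cJ u) (cJ v) = Btrace u v.
Proof. by congr tr; apply/funext => w; exact: B_JJ. Qed.

Lemma trD (f g : T -> T) : tr (fun u => f u + g u) = tr f + tr g.
Proof. by have := tr_linear 1 f g; rewrite mul1r => <-; congr tr; apply/funext => u; rewrite scale1r. Qed.

Lemma tr0 : tr (fun _ : T => 0 : T) = 0.
Proof. by rewrite trE big1// => i _; rewrite mxE. Qed.

Lemma trZ (a : R) (f : T -> T) : tr (fun u => a *: f u) = a * tr f.
Proof. by have := tr_linear a f (fun=> 0); rewrite tr0 addr0 => <-; congr tr; apply/funext => u; rewrite addr0. Qed.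

Lemma trN (f : T -> T) : tr (fun u => - f u) = - tr f.
Proof. by rewrite -mulN1r -trZ; congr tr; apply/funext => u; rewrite scaleN1r. Qed.

Lemma Btrace_N u v : Btrace u (- v) = - Btrace u v.
Proof.
rewrite /Btrace -trN; congr tr; apply/funext => w.
by rewrite (BC (- v)) BN BN (BC w).
Qed.

(** With the symmetry of [Btrace] this says that [twistJ Btrace] is skew, so anti-symmetrization
    leaves it unchanged. *)
Lemma Btrace_Jl u v : Btrace (cJ u) v = - Btrace u (cJ v).
Proof. by rewrite -Btrace_JJ JJ BtraceC Btrace_N BtraceC. Qed.

(** As functions of the traced vector u, the quadratic terms are B_{B_v w} u, which is traceless
    because it anticommutes with J, and B_v B_w u, with trace [Btrace v w]. In the Q terms Tr Id =
    2n and Tr J = 0; the others have rank one, and together they turn - 2n Q(v, w) into - (2n + 1)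
    Q(v, w). *)
Lemma Ric_formula v w : Ric D x v w =
  4^-1 * Btrace v w - (n%:R * 2 + 1) * Q v w + Q w v
  - (Q (cJ v) (cJ w) + Q (cJ w) (cJ v)).
Proof.
rewrite /Ric.
have -> : (fun u => Rm D x u v w) = (fun u =>
  (- 4^-1) *: B (B v w) u + (4^-1 *: B v (B w u) + ((- Q v w) *: u + (Q v (cJ w) *: cJ u
   + (Q u w *: v + (- (Q u (cJ w) *: cJ v) + (Q u v *: w + (- (Q v u) *: w + (- (Q u (cJ v) *: cJ w)
   + Q v (cJ u) *: cJ w))))))))).
  apply/funext => u; rewrite curvE (BC u (B v w)) (BC u w).
  apply: (Jseparates (Cn_ok R n)) => L LD LN LZ; rewrite !(LD, LN, LZ).
  move: (L (B (B v w) u)) (L (B v (B w u))) (L u) (L v) (L w) (L (cJ u)) (L (cJ v)) (L (cJ w)) => *; ring.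
rewrite tr_linear (@tr_anti R n (B (B v w)))//.
rewrite tr_linear -/(Btrace v w) tr_linear tr_id tr_linear tr_J.
rewrite trD (tr_rank1 v (k := fun u => Q u w)); last by move=> *; rewrite QPl.
rewrite trD trN (tr_rank1 (cJ v) (k := fun u => Q u (cJ w))); last by move=> *; rewrite QPl.
rewrite trD (tr_rank1 w (k := fun u => Q u v)); last by move=> *; rewrite QPl.
rewrite trD (tr_rank1 w (k := fun u => - Q v u)); last by move=> *; rewrite QPr; ring.
rewrite trD trN (tr_rank1 (cJ w) (k := fun u => Q u (cJ v))); last by move=> *; rewrite QPl.
rewrite (tr_rank1 (cJ w) (k := fun u => Q v (cJ u))); last by move=> *; rewrite JP QPr.
rewrite JJ QNr natrD.
move: (Q v w) (Q w v) (Q (cJ v) (cJ w)) (Q (cJ w) (cJ v)) (Q v (cJ w)) (Btrace v w) (n%:R : R) => *; ring.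
Qed.

(** [Btrace] is symmetric and J-invariant, so the correction with 1 / (n - 1) does not see it. On
    the Q terms the correction is - Q(v, w) - Q(w, v) + Q(Jv, Jw) + Q(Jw, Jv), which leaves - (2n +
    2) Q(v, w). The hypothesis n >= 2 makes n - 1 invertible. *)
Lemma Rho_formula v w : Rho D x v w = (4 * (n%:R + 1))^-1 * Btrace v w - 2 * Q v w.
Proof.
have n1 : n%:R + 1 != 0 :> R by rewrite natr1 pnatr_eq0.
have n2 : n%:R - 1 != 0 :> R by rewrite subr_eq0 pnatr_eq1 gtn_eqF.
rewrite /Rho /symm !Ric_formula !JJ !QNl !QNr !opprK !Btrace_JJ (BtraceC w v).
move: (Q v w) (Q w v) (Q (cJ v) (cJ w)) (Q (cJ w) (cJ v)) (Btrace v w) n1 n2.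
move: (n%:R : R) => m q1 q2 q3 q4 b n1 n2; field.
by rewrite n1 n2.
Qed.

Lemma cWeyl_formula u v w : cWeyl D x u v w =
  - 4^-1 *: (B u (B v w) - B v (B u w))
  - (4 * (n%:R + 1))^-1 *: tens (twistJ Btrace) cJ u v w
  + (8 * (n%:R + 1))^-1 *: wedge Btrace id u v w
  - (8 * (n%:R + 1))^-1 *: wedge (twistJ Btrace) cJ u v w.
Proof.
have n1 : n%:R + 1 != 0 :> R by rewrite natr1 pnatr_eq0.
rewrite /cWeyl /tens /wedge /anti /twistJ !Rho_formula curvE (BtraceC v u).
rewrite (BtraceC v (cJ u)) Btrace_Jl.
apply: (Jseparates (Cn_ok R n)) => L LD LN LZ; rewrite !(LD, LN, LZ).
move: (Q u v) (Q v u) (Q u w) (Q v w) (Q u (cJ v)) (Q v (cJ u)) (Q u (cJ w)) (Q v (cJ w)).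
move: (Btrace u v) (Btrace u (cJ v)) (Btrace u w) (Btrace v w) (Btrace u (cJ w)) (Btrace v (cJ w)).
move: (L (B u (B v w))) (L (B v (B u w))) (L u) (L v) (L w) (L (cJ u)) (L (cJ v)) (L (cJ w)).
move: (n%:R : R) n1 => m n1 *; field.
by rewrite n1.
Qed.

(** Inserting J in both form slots sends calB /\ Id to - calB_J /\ J and vice versa, and these two
    terms have opposite coefficients. The other terms are invariant by [B_JJ] and [Btrace_JJ]. *)
Lemma cWeyl_type11 u v w : cWeyl D x (cJ u) (cJ v) w = cWeyl D x u v w.
Proof.
rewrite !cWeyl_formula /tens /wedge /twistJ !Btrace_Jl !JJ !B_JJ.
rewrite !Btrace_N !opprK.
apply: (Jseparates (Cn_ok R n)) => L LD LN LZ; rewrite !(LD, LN, LZ).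
move: (Btrace u (cJ v)) (Btrace u w) (Btrace v w) (Btrace u (cJ w)) (Btrace v (cJ w)).
move: (L (B u (B v w))) (L (B v (B u w))) (L u) (L v) (L (cJ u)) (L (cJ v)) (L (cJ w)).
move: ((4 * (n%:R + 1))^-1 : R) ((8 * (n%:R + 1))^-1 : R) => *; ring.
Qed.
End WeylAlgebra.

(** Unfolds the choices in [Bbar]: the point of the fibre is the chosen [z], and [dmap_covJ] handles
    the chosen lifts. Of the angle only c^2 + s^2 = 1 is kept, as products of two such tensors
    depend on it in no other way. *)
Lemma Bbar_rotation (R : realType) (E F : cmodel R) (okE : cmodel_ok E)
    (N : charted E) (Nb : charted F) (hN : is_complex_manifold N)
    (hNb : is_complex_manifold Nb) (act : cE (C1 R) -> N -> N) (p : N -> Nb)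
    (hB : holo_principal_bundle act p) (nabla : covop N) (xi : vfield N)
    (hC : conical_special_complex nabla xi) (gen : generated_by act xi)
    (h : N -> cE F -> cE E) (h_proj : forall z u, dmap p z (h z u) = u)
    (t : local_triv act p) (x : Nb) : triv_dom t x ->
  exists z, p z = x /\ exists c s : R, c ^+ 2 + s ^+ 2 = 1 /\
    forall u v, Bbar nabla t x u v =
      c *: Bform p nabla h z u v + s *: cJ (Bform p nabla h z u v).
Proof.
move=> tx.
have hp : smooth_map_on setT p by case: (proj_holo hB).
pose z := xget (triv_inv t (x, cone R)) [set z | p z = x].
have one0 : cone R != 0 :> cE (C1 R).
  by apply/eqP => /(congr1 fst) /= /eqP; rewrite oner_eq0.
have pz : p z = x.
  apply: (@xgetPex _ (triv_inv t (x, cone R)) [set z | p z = x]).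
  by exists (triv_inv t (x, cone R)); exact: triv_p_inv.
exists z; split=> //.
pose theta := get [set th : R | exists2 r : R, 0 < r &
  triv_phi t z = (r * cos th, r * sin th)].
exists (cos (2 * theta)), (sin (2 * theta)); split; first exact: cos2Dsin2.
move=> u v.
pose l w := xget 0 [set w' | dmap p z w' = w].
have lP w : dmap p z (l w) = w.
  have [w' ew] := dmap_onto hN hNb hB z w.
  exact: (@xgetPex _ 0 [set w' | dmap p z w' = w] (ex_intro _ w' ew)).
rewrite -[LHS]/(dmap p z (cos (2 * theta) *: covJ nabla z (l u) (l v) +
   sin (2 * theta) *: cJ (covJ nabla z (l u) (l v)))).
rewrite (dmapP hp) (lfunZ (dmapP hp z)) (dmap_proj_J hB).
by rewrite (dmap_covJ okE hN hNb hB hC gen h_proj) !lP.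
Qed.

Theorem theorem7p10 (R : realType) (n : nat)
    (N : complex_manifold R n.+1) (Nb : complex_manifold R n)
    (nabla : covop N) (xi : vfield N)
    (act : cE (C1 R) -> N -> N) (p : N -> Nb)
    (n_ge2 : (2 <= n)%N)
    (N_conical : conical_special_complex nabla xi)
    (p_bundle : holo_principal_bundle act p)
    (p_generated : generated_by act xi) :
  forall D : covop Nb, canonical_cproj act p nabla D ->
    (forall (t : local_triv act p) (x : Nb), triv_dom t x ->
       let B := Bbar nabla t x in
       let calB := fun X Y => tr (fun Z => B X (B Y Z)) in
       forall X Y Z : cE (Cn R n),
         cWeyl D x X Y Z =
           - 4^-1 *: (B X (B Y Z) - B Y (B X Z))
           - (4 * (n%:R + 1))^-1 *: tens (twistJ calB) cJ X Y Z
           + (8 * (n%:R + 1))^-1 *: wedge calB id X Y Z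
           - (8 * (n%:R + 1))^-1 *: wedge (twistJ calB) cJ X Y Z)
    /\
    (forall (x : Nb) (X Y Z : cE (Cn R n)),
       cWeyl D x (cJ X) (cJ Y) Z = cWeyl D x X Y Z).
Proof.
move=> D [eta [D0 [he [_ ind0] [[[hD _] tD] _ [a ha rel]]]]].
have okN := Cn_ok R n.+1; have okb := Cn_ok R n.
have hN := mfdP N; have hNb := mfdP Nb.
have sxi z : smooth_vf xi z by case: N_conical.
pose h := clift p xi eta a.
have h_linear := clift_linear okN okb hN hNb p_bundle p_generated he ha.
have h_J := clift_J okN okb hN hNb p_bundle p_generated he ha.
have h_proj := clift_proj hN hNb p_bundle p_generated he a.
have h_smooth := clift_smooth okN okb hN hNb p_bundle p_generated sxi he ha.
(* The one-form [a] relating [D] to [D0] is absorbed here: [D] itself is induced by the lift [h]. *)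
have hind (Y : vfield Nb) z : smooth_vf Y (p z) -> forall u,
    D Y (p z) u = dmap p z (covprime nabla (fun y => h y (Y (p y))) z (h z u)).
  move=> sY u; rewrite (clift_induced okN okb hN hNb p_bundle N_conical p_generated he ha u sY).
  by rewrite (rel _ _ sY) ind0.
have curvE := induced_curvature okN okb hN hNb p_bundle N_conical p_generated he
  h_linear h_J h_proj (fun Y z => @h_smooth Y z) hD tD hind.
have BP z := Bform_linear okN hN p_bundle N_conical h_linear z.
have BC z := BformC p N_conical h z.
have BJ z := BformJ okN hN p_bundle N_conical h_J z.
have QPl z := Qform_linear_l okN hN hNb N_conical he h_linear (fun Y z => @h_smooth Y z) hD z.
have QPr z := Qform_linear_r okN hN hNb p_bundle N_conical he h_linear (fun Y z => @h_smooth Y z) hD z.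
split=> [t x tx B calB X Y Z|x X Y Z].
  have [z [ez [c [s [cs eB]]]]] := Bbar_rotation okN hN hNb p_bundle N_conical p_generated h_proj tx.
  (* Anticommutation turns the product of the rotations into (c + s J)(c - s J) = c^2 + s^2 = 1. *)
  have BB u v w : B u (B v w) = Bform p nabla h z u (Bform p nabla h z v w).
    rewrite /B !eB.
    set b := Bform p nabla h z v w.
    rewrite BP (lfunZ (fun a v w => BP z a u v w)) BJ.
    have := model_JJ okb (Bform p nabla h z u b); set bb := Bform p nabla h z u b => JJ.
    rewrite (cJD okb) !(cJZ okb) (cJN okb) JJ.
    apply: (Jseparates okb) => L LD LN LZ; rewrite !(LD, LN, LZ).
    rewrite -[RHS]mul1r -cs; move: (L bb) (L (cJ bb)) => *; ring.
  have -> : calB = Btrace (Bform p nabla h z).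
    apply/funext => u; apply/funext => v; rewrite /calB /Btrace; congr tr.
    by apply/funext => w; exact: BB.
  rewrite !BB -ez.
  exact: (cWeyl_formula n_ge2 (BP z) (BC z) (BJ z) (QPl z) (QPr z) (curvE z)).
(* A trivialization around [x] provides a point of its fibre, at which the curvature formula is
   available. *)
have [t _ tx] := proj_triv p_bundle x.
have [z [ez _]] := Bbar_rotation okN hN hNb p_bundle N_conical p_generated h_proj tx.
rewrite -ez.
exact: (cWeyl_type11 n_ge2 (BP z) (BC z) (BJ z) (QPl z) (QPr z) (curvE z)).
Qed.
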